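(* For every positive integer $r$ there is an $\aleph_1$-separable abelian group $M=M_r$ of cardinality $\aleph_1$ such that for all positive integers $m$ and $k$, $M^m$ is isomorphic to $M^k$ if and only if $m\equiv k \pmod r$.
   Context: An abelian group $M$ is $\aleph_1$-separable if every countable subset of $M$ is contained in a countable free (abelian) direct summand of $M$. For a group $M$ and positive integer $m$, $M^m$ denotes the direct sum of $m$ copies of $M$. This is proved in ZFC. *)

(* Defs.v *)
From mathcomp Require Import all_boot all_order all_algebra.
Set Implicit Arguments. Unset Strict Implicit. Unset Printing Implicit Defensive.
Import GRing.Theory.
Local Open Scope ring_scope.

Definition countable_set (T : Type) (S : T -> Prop) : Prop :=
  exists f : T -> nat, forall x y, S x -> S y -> f x = f y -> x = y.

Definition is_subgroup (M : zmodType) (S : M -> Prop) : Prop :=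
  S 0 /\ forall x y, S x -> S y -> S (x - y).

Definition is_basis (M : zmodType) (F B : M -> Prop) : Prop :=
  (forall b, B b -> F b) /\
  (forall (s : seq M) (c : seq int), uniq s -> (forall y, y \in s -> B y) ->
     size c = size s ->
     \sum_(i < size s) (s`_i *~ c`_i) = 0 -> forall i, c`_i = 0%Z) /\
  (forall x, F x -> exists (s : seq M) (c : seq int),
     (forall y, y \in s -> B y) /\ size c = size s /\
     x = \sum_(i < size s) (s`_i *~ c`_i)).

Definition free_subgroup (M : zmodType) (F : M -> Prop) : Prop :=
  is_subgroup F /\ exists B : M -> Prop, is_basis F B.

Definition direct_summand (M : zmodType) (F : M -> Prop) : Prop :=
  is_subgroup F /\
  exists C : M -> Prop, is_subgroup C /\
    (forall x, F x -> C x -> x = 0) /\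
    (forall x, exists a b, F a /\ C b /\ x = a + b).

Definition aleph1_separable (M : zmodType) : Prop :=
  forall S : M -> Prop, countable_set S ->
    exists F : M -> Prop, countable_set F /\ free_subgroup F /\
      direct_summand F /\ (forall x, S x -> F x).

(* |T| = aleph_1: T is uncountable and carries a strict well-order all of whose
   proper initial segments are countable (i.e. of order type omega_1). *)
Definition card_aleph1 (T : Type) : Prop :=
  ~ countable_set (fun _ : T => True) /\
  exists R : T -> T -> Prop,
    (forall x, ~ R x x) /\
    (forall x y z, R x y -> R y z -> R x z) /\
    (forall x y, x <> y -> R x y \/ R y x) /\
    well_founded R /\
    (forall x, countable_set (fun y => R y x)).

Definition group_iso (A B : zmodType) : Prop :=
  exists f : A -> B, (forall x y, f (x + y) = f x + f y) /\ bijective f.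

(* Main.v *)
(* Fix d = r + 1 and a countable group H, the union of a chain of groups H_k embeddable
   in powers of Z. The group M consists of functions f on omega_1 x nat with f(b, k) in H_k
   which, near each limit ordinal D, take one value h (the germ of f at D) on the rungs
   (D_k, k) of a fixed ladder D_0, D_1, ... -> D and vanish elsewhere. Restricting to an
   initial segment splits off a countable summand, and countable subgroups of powers of Z
   are free, so M is aleph_1-separable.
   An isomorphism M^m -> M^n preserves, for some limit D, the functions of support bounded
   below D. Elements which are p-divisible to all orders modulo those vanish from D on, so
   if H is spanned by such elements then taking germs at D yields an isomorphism H^m -> H^n.
   For H take L, the ring generated over Z by the Leavitt operators x_i : e_q |-> e_(d q + i)
   and their transposes y_i, and in (L (x) Q)^2 the sum of the p_o-localizations of the
   lines {(0, u)}, {(u, 0)}, {(u, u)}, {(u, u x_i)}, {(u, u y_i)} for distinct primes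
   p_o > r. Left multiplication by the x_i and y_i gives H = H^d, hence M = M^d. Conversely
   an isomorphism H^m -> H^n respects the lines, so it is given by a matrix over L with
   denominators prime to r, and the trace of L modulo r gives m = n modulo r. *)
From HB Require Import structures.
Require Import Defs.
From mathcomp Require Import all_boot all_order all_algebra.
From mathcomp Require Import boolp functions wochoice.
From mathcomp Require Import zify ring.
Set Implicit Arguments. Unset Strict Implicit. Unset Printing Implicit Defensive.
Import Order.TTheory GRing.Theory Num.Theory.

(** * Countable sets and omega_1 *)

Lemma countable_sub (T : Type) (S S' : T -> Prop) :
  (forall x, S x -> S' x) -> countable_set S' -> countable_set S.
Proof. by move=> sub [f fi]; exists f => x y /sub Sx /sub Sy; apply: fi. Qed.

Lemma countable_image (T U : Type) (S : T -> Prop) (S' : U -> Prop) (f : T -> U) :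
  countable_set S -> (forall y, S' y -> exists2 x, S x & f x = y) ->
  countable_set S'.
Proof.
move=> [c ci] sf.
pose g y := match pselect (S' y) with
  | left h => c (projT1 (cid2 (sf y h))) | right _ => 0 end.
exists g => x y S'x S'y; rewrite /g; case: pselect => // hx; case: pselect => // hy.
case: cid2 => a /= Sa <-; case: cid2 => b /= Sb <- e; congr f; exact: ci.
Qed.

Lemma countType_countable (C : countType) (S : C -> Prop) : countable_set S.
Proof. by exists (@pickle C) => x y _ _ /(pcan_inj pickleK). Qed.

Definition is_limit (W : Type) (lt : W -> W -> Prop) (d : W) :=
  (exists b, lt b d) /\ forall b, lt b d -> exists2 b', lt b b' & lt b' d.

(** Enumerate the countably many points below [d] and choose each new rung below [d], above both the
    previous rung and the next enumerated point. Every [g] below [d] is enumerated at some stage and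
    stays below all later rungs. *)
Lemma ladder_exists (W : Type) (lt : W -> W -> Prop) (d : W) :
  (forall x y z, lt x y -> lt y z -> lt x z) ->
  (forall x y, x <> y -> lt x y \/ lt y x) ->
  countable_set (fun y => lt y d) -> is_limit lt d ->
  exists l : nat -> W, (forall k, lt (l k) d) /\
    forall g, lt g d -> exists n, forall k, n <= k -> lt g (l k).
Proof.
move=> tr tot [c ci] [[b0 b0d] lim].
have ub x y : lt x d -> lt y d -> {z | [/\ lt x z, lt y z & lt z d]}.
  move=> xd yd; apply: cid.
  have [z xz zd] := lim _ xd; have [t yt td] := lim _ yd.
  have [e|/tot[ltzt|lttz]] := pselect (z = t).
  - by exists z; split=> //; rewrite e.
  - by exists t; split=> //; apply: tr ltzt.
  - by exists z; split=> //; apply: tr lttz.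
pose en k := match pselect (exists2 y, lt y d & c y = k) with
  | left h => projT1 (cid2 h) | right _ => b0 end.
have end_ k : lt (en k) d.
  by rewrite /en; case: pselect => // h; case: cid2.
pose nx k (x : {x | lt x d}) : {x | lt x d} :=
  let u := ub _ _ (proj2_sig x) (end_ k) in
  let: And3 _ _ h := proj2_sig u in exist _ (proj1_sig u) h.
pose fix l k : {x | lt x d} := if k is k'.+1 then nx k' (l k') else exist _ b0 b0d.
have lS k : lt (proj1_sig (l k)) (proj1_sig (l k.+1)) /\ lt (en k) (proj1_sig (l k.+1)).
  by rewrite /= /nx; case: (ub _ _ _ _) => z /= [].
exists (fun k => proj1_sig (l k)); split=> [k|g gd]; first exact: (proj2_sig (l k)).
have eg : en (c g) = g.
  rewrite /en; case: pselect => [h|[]]; last by exists g.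
  by case: cid2 => /= y yd e; exact: ci.
exists (c g).+1; elim=> // k IH; rewrite leq_eqVlt => /predU1P[[<-]|/IH h].
  by have [] := lS (c g); rewrite eg.
by apply: tr h _; have [] := lS k.
Qed.

(** Well-order the sequences [nat -> bool] and keep the points whose initial segment is
    countable. *)
Lemma omega1_exists : exists (W : Type) (lt : W -> W -> Prop),
  [/\ (forall x, ~ lt x x), (forall x y z, lt x y -> lt y z -> lt x z),
      (forall x y, x <> y -> lt x y \/ lt y x), well_founded lt &
      (forall x, countable_set (fun y => lt y x)) /\
      ~ countable_set (fun _ : W => True)].
Proof.
pose T : eqType := nat -> bool.
have [R Rwo] := well_ordering_principle T.
have minE (P : T -> Prop) : (exists x, P x) ->
    exists x, P x /\ forall y, P y -> R x y.
  move=> [x Px]; have [|z [[Pz zmin] _]] := Rwo [pred x | `[<P x>]].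
    by exists x; apply/asboolP.
  by exists z; split; [apply/asboolP|move=> y Py; apply: zmin; apply/asboolP].
have tot x y : R x y \/ R y x.
  have [z [[<-|<-] h]] := minE (fun z => x = z \/ y = z) (ex_intro _ x (or_introl erefl)).
    by left; apply: h; right.
  by right; apply: h; left.
(* Antisymmetry is the uniqueness of the least element of the pair [x], [y]. *)
have anti x y : R x y -> R y x -> x = y.
  move=> xy yx.
  have [|z [_ uz]] := Rwo [pred z | (z == x) || (z == y)].
    by exists x; rewrite inE eqxx.
  have rx t : R t t by have [] := tot t t.
  rewrite -(uz x); last first.
    by split=> [|t]; rewrite inE ?eqxx //= => /orP[] /eqP->.
  by apply: uz; split=> [|t]; rewrite inE ?eqxx ?orbT //= => /orP[] /eqP->.
have rtr x y z : R x y -> R y z -> R x z.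
  move=> xy yz.
  have [t [ht tmin]] := minE (fun t => [\/ t = x, t = y | t = z]) (ex_intro _ x (Or31 _ _ erefl)).
  case: ht tmin => -> h; first by apply: h; apply: Or33.
    by rewrite (anti x y) //; apply: h; apply: Or31.
  by rewrite -(anti y z) // ; apply: h; apply: Or32.
pose ltT x y := R x y /\ x <> y.
have ltirr x : ~ ltT x x by case.
have lttr x y z : ltT x y -> ltT y z -> ltT x z.
  move=> [xy nxy] [yz nyz]; split; first exact: rtr yz.
  by move=> xz; subst z; apply: nxy; apply: anti.
have lttot x y : x <> y -> ltT x y \/ ltT y x.
  by move=> xy; case: (tot x y) => h; [left|right]; split=> // e; apply: xy.
have ltwf : well_founded ltT.
  apply: contrapT => /existsNP nacc.
  have [x [nx xmin]] := minE _ nacc; apply: nx; constructor=> y [yx nyx].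
  apply: contrapT => ny; apply: nyx; exact/anti/xmin.
pose W := {y : T | countable_set (fun x => ltT x y)}.
pose lt (x y : W) := ltT (proj1_sig x) (proj1_sig y).
have sigE (x y : W) : proj1_sig x = proj1_sig y -> x = y.
  by case: x y => x hx [y hy] /= e; subst y; congr exist; apply: Prop_irrelevance.
exists W, lt; split=> [x|x y z|x y nxy|[x hx]|]; rewrite /lt.
- exact: ltirr.
- exact: lttr.
- by apply: lttot => /sigE.
- elim: (ltwf x) hx => {}x _ IH hx; constructor=> -[y hy] yx; exact: IH.
split=> [[x hx] /=|[c ci]].
  by case: hx => c ci; exists (fun y => c (proj1_sig y)) => y z yx zx e; apply/sigE/ci.
(* If some segment is uncountable, the predecessors of the least such point [y] all lie in [W], so
   countability of [W] would make that segment countable. Otherwise [W] is everything, and Cantor's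
   diagonal set [D] refutes the injection [g]. *)
have [[y0 ny0]|all] := pselect (exists y, ~ countable_set (fun x => ltT x y)).
  have [y [ny ymin]] : exists y, ~ countable_set (fun x => ltT x y) /\
      forall z, ~ countable_set (fun x => ltT x z) -> R y z.
    by apply: minE; exists y0.
  apply: ny.
  apply: (@countable_image W T (fun => True) _ (@proj1_sig _ _)); first by exists c.
  move=> x [xy nxy].
  have hx : countable_set (ltT^~ x).
    by apply: contrapT => nx; apply: nxy; apply: anti (ymin _ nx).
  by exists (exist _ x hx).
have all' y : countable_set (fun x => ltT x y).
  by apply: contrapT => h; apply: all; exists y.
pose g y : nat := c (exist _ y (all' y)).
have gi : injective g by move=> x y /ci - /(_ I I) [].
pose D : T := fun n => `[< exists2 y, g y = n & ~~ y n >].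
case: (boolP (D (g D))) => h; move/asboolP: (h).
  by case=> y /gi -> /negP.
by case; exists D.
Qed.

(** * Countable subgroups of powers of Z *)

Local Open Scope ring_scope.

Lemma additive_of (U V : zmodType) (f : U -> V) :
  {morph f : x y / x + y} -> exists g : {additive U -> V}, g =1 f.
Proof.
move=> fD; have f0 : f 0 = 0 by apply: (addrI (f 0)); rewrite -fD !addr0.
have fB : zmod_morphism f.
  move=> x y; rewrite fD; congr (_ + _); apply: (addrI (f y)).
  by rewrite -fD !subrr f0.
pose m := GRing.isZmodMorphism.Build U V f fB.
pose g : {additive U -> V} := HB.pack f m.
by exists g.
Qed.

Section Subgroup.
Variables (G : zmodType) (F : G -> Prop).
Hypothesis hF : is_subgroup F.

Lemma subgroupN x : F x -> F (- x).
Proof. by case: hF => F0 FB Fx; rewrite -sub0r; apply: FB. Qed.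

Lemma subgroupD x y : F x -> F y -> F (x + y).
Proof. by case: hF => F0 FB Fx /subgroupN ?; rewrite -[y]opprK; apply: FB. Qed.

Lemma subgroupMn x n : F x -> F (x *+ n).
Proof.
by move=> Fx; elim: n => [|n IH]; [exact: hF.1|rewrite mulrS; apply: subgroupD].
Qed.

Lemma subgroupMz x c : F x -> F (x *~ c).
Proof.
move=> Fx; case: c => n; first exact: subgroupMn.
by rewrite NegzE mulrNz; apply/subgroupN/subgroupMn.
Qed.

End Subgroup.

Lemma additive_pointwise (G : zmodType) (I : Type) (t : G -> I -> int) :
  {morph t : x y / x + y} -> forall x y c i, t (x - y *~ c) i = t x i - t y i * c.
Proof.
move=> /additive_of[g gE] x y c i; rewrite -!gE raddfB raddfMz [LHS]/= -[_ i]/(_ + _).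
congr (_ - _); rewrite -mulrzz.
case: c => n; rewrite ?NegzE ?mulrNz; last congr (- _); by rewrite -!pmulrn natmulfctE.
Qed.

(* Splits off from the image of [t] the pure rank one subgroup generated by [t g]:
   [b] minimises a nonzero [i]-th coordinate there, and
   [t' x = t b i * t x - t x i * t b] has kernel [ker t + Z b]. *)
Lemma split_pure_rank1 (G : zmodType) (F : G -> Prop) (I : Type) (t : G -> I -> int)
    (g : G) : is_subgroup F -> {morph t : x y / x + y} -> F g ->
  exists bt : G * (G -> I -> int), [/\ {morph bt.2 : x y / x + y}, F bt.1,
    bt.2 g = 0, t bt.1 = 0 -> bt.1 = 0 &
    forall x, F x -> (bt.2 x = 0 <-> exists c, t (x - bt.1 *~ c) = 0)].
Proof.
move=> Fs tD Fg; have [F0 FB] := Fs; have tE := additive_pointwise tD.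
have [tg0|/eqP tgn0] := eqVneq (t g) 0.
  exists (0, t); split=> // x _; split=> [e|[c]]; last by rewrite mul0rz subr0.
  by exists 0; rewrite subr0.
have [i tgi] : exists i, t g i != 0.
  by apply: contra_notP tgn0 => h; apply/funext => i; apply/eqP/negPn/negP => ?; apply: h; exists i.
pose P b := [/\ F b, t b i != 0 & forall j, t g i * t b j = t b i * t g j].
have exP : exists n : nat, `[< exists2 b, P b & n = `|t b i|%N >].
  by exists `|t g i|%N; apply/asboolP; exists g => //; split=> // j; rewrite mulrC.
case: (ex_minnP exP) => n /asboolP[b [Fb tbi bg] ->] bmin.
pose t' x j := t b i * t x j - t x i * t b j.
exists (b, t'); split=> //=.
- move=> x y; apply/funext => j; rewrite /t' tD -[RHS]/(_ + _) /=.
  rewrite -[(t x + t y) i]/(t x i + t y i) -[(t x + t y) j]/(t x j + t y j); ring.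
- by apply/funext => j; rewrite /t' -bg subrr.
- by move=> tb0; move: tbi; rewrite tb0 eqxx.
move=> x Fx; split=> [t'x|[c cE]]; last first.
  have e j : t x j = t b j * c by apply/eqP; rewrite -subr_eq0 -tE cE.
  by apply/funext => j; rewrite /t' !e -[RHS]/0; ring.
have xb j : t b i * t x j = t x i * t b j.
  by apply/eqP; rewrite -subr_eq0 -[_ - _]/(t' x j) t'x.
(* Division with remainder: [t y] is proportional to [t b] and its [i]-th coordinate is a remainder
   modulo [t b i]. By minimality of [b] that coordinate is 0, hence so is [t y]. *)
pose c := (t x i %/ t b i)%Z; exists c; set y := x - b *~ c.
have yi : t y i = (t x i %% t b i)%Z by rewrite tE /modz /c mulrC.
have yb j : t b i * t y j = t y i * t b j.
  by rewrite !tE mulrBr xb; ring.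
have yi0 : t y i = 0.
  apply/eqP/negPn/negP => yi0.
  suff : (`|t b i| <= `|t y i|)%N by rewrite yi leqNgt -ltz_nat !abszE ger0_norm ?modz_ge0 // ltz_mod.
  apply: bmin; apply/asboolP; exists y => //; split=> // [|j]; first exact/FB/(subgroupMz Fs).
  apply: (mulfI tbi); rewrite mulrCA yb mulrCA (mulrC _ (t b j)) mulrA.
  by rewrite (mulrAC (t y i)) -mulrA bg; ring.
apply/funext => j; apply: (mulfI tbi); rewrite yb yi0 mul0r -[(0 : I -> int) j]/0.
by rewrite mulr0.
Qed.

Lemma countable_enum (T : Type) (F : T -> Prop) (x0 : T) : F x0 -> countable_set F ->
  exists g : nat -> T, (forall n, F (g n)) /\ forall x, F x -> exists n, g n = x.
Proof.
move=> Fx0 [c ci].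
pose g n := match pselect (exists2 y, F y & c y = n) with
  | left h => projT1 (cid2 h) | right _ => x0 end.
exists g; rewrite /g; split=> [n|x Fx]; first by case: pselect => // h; case: cid2.
exists (c x); case: pselect => [h|[]]; last by exists x.
by case: cid2 => y Fy e; exact: ci.
Qed.

(** Iterating [split_pure_rank1] along an enumeration [g] of [F] gives maps [t n] whose kernels in
    [F] increase from 0: the kernel of [t n.+1] contains [g n] and is that of [t n] plus the
    multiples of [b n]. The kernels exhaust [F], and the nonzero [b n] form a basis. *)
Lemma countable_free (G : zmodType) (F : G -> Prop) (I : Type) (e : G -> I -> int) :
  {morph e : x y / x + y} -> is_subgroup F -> countable_set F ->
  (forall x, F x -> e x = 0 -> x = 0) -> free_subgroup F.
Proof.
move=> eD Fs Fc einj; have [F0 FB] := Fs.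
have [g [Fg gsurj]] := countable_enum F0 Fc.
pose St := {t : G -> I -> int | {morph t : x y / x + y}}.
have stp (t : St) n : {bt : G * St | [/\ F bt.1, sval bt.2 (g n) = 0,
   sval t bt.1 = 0 -> bt.1 = 0 &
   forall x, F x -> (sval bt.2 x = 0 <-> exists c, sval t (x - bt.1 *~ c) = 0)]}.
  apply: cid; case: t => t tD.
  have [[b t'] /= [t'D Fb t'g tb h]] := split_pure_rank1 Fs tD (Fg n).
  by exists (b, exist _ t' t'D).
pose fix st n : St := if n is m.+1 then (sval (stp (st m) m)).2 else exist _ e eD.
pose t n := sval (st n); pose b n := (sval (stp (st n) n)).1.
have tD n : {morph t n : x y / x + y} by rewrite /t; case: (st n).
have tE n := additive_pointwise (tD n).
have bP n : [/\ F (b n), t n.+1 (g n) = 0, t n (b n) = 0 -> b n = 0 &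
   forall x, F x -> (t n.+1 x = 0 <-> exists c, t n (x - b n *~ c) = 0)].
  by rewrite /b /t /=; case: (stp (st n) n).
have t0n n : t n 0 = 0 by apply/funext => i; rewrite -(subrr 0) -{2}[0]mulr1z tE mulr1 subrr.
have tS n x : F x -> t n x = 0 -> t n.+1 x = 0.
  by move=> Fx tx; have [_ _ _ h] := bP n; apply/h => //; exists 0; rewrite subr0.
have tle n m x : (n <= m)%N -> F x -> t n x = 0 -> t m x = 0.
  move=> /subnK <- Fx tx; elim: (m - n)%N => // k IH.
  exact: tS.
have Fb n : F (b n) by have [] := bP n.
have tb n : t n.+1 (b n) = 0.
  by have [_ _ _ h] := bP n; apply/h => //; exists 1; rewrite mulr1z subrr.
have gen n x : F x -> t n x = 0 -> exists c : nat -> int, x = \sum_(0 <= i < n) b i *~ c i.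
  elim: n x => [|n IH] x Fx tx.
    by exists (fun=> 0); rewrite big_geq //; exact: einj.
  have [_ _ _ /(_ x Fx)[/(_ tx)[c tc] _]] := bP n.
  have [c' xE] := IH _ (FB _ _ Fx (subgroupMz Fs c (Fb n))) tc.
  exists (fun i => if (i < n)%N then c' i else c).
  rewrite big_nat_recr //= ltnn; apply/eqP; rewrite -subr_eq xE; apply/eqP.
  by apply: eq_big_nat => i /andP[_ ->].
split=> //; exists (fun y => y != 0 /\ exists n, y = b n); split; [|split].
- by move=> _ [_ [n ->]].
- move=> s c us sB szc s0.
  have cs i : (size s <= i)%N -> c`_i = 0 by move=> ?; rewrite nth_default ?szc.
  have sB' i : (i < size s)%N -> s`_i != 0 /\ exists n, s`_i = b n.
    by move=> ?; apply: sB; rewrite mem_nth.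
  have /choice[r rE] : forall i, exists n, (i < size s)%N -> s`_i = b n.
    move=> i; case: (ltnP i (size s)) => [/sB'[_ [n ->]]|_]; last by exists 0.
    by exists n.
  have rinj i j : (i < size s)%N -> (j < size s)%N -> r i = r j -> i = j.
    by move=> ilt jlt rij; apply/eqP; rewrite -(nth_uniq 0 ilt jlt us) (rE i) ?(rE j) ?rij.
  suff h (i : 'I_(size s)) : c`_i = 0.
    move=> i; case: (ltnP i (size s)) => [ilt|/cs //].
    exact: (h (Ordinal ilt)).
  apply/eqP/negPn/negP => ci.
  (* Take the term of largest index [r k] with nonzero coefficient. The map [t (r k)] kills every
     other term but not [b (r k)], so a coordinate where [t (r k) (b (r k))] is nonzero forces the
     coefficient to vanish. *)
  have [k ck kmax] := @arg_maxnP _ i (fun i => c`_i != 0) (fun i => r i) ci.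
  have [sk0 _] := sB' _ (ltn_ord k).
  have [_ _ tk _] := bP (r k).
  have [j tj] : exists j, t (r k) (b (r k)) j != 0.
    apply: contrapT => h; move: sk0; rewrite (rE _ (ltn_ord k)) tk ?eqxx //.
    by apply/funext => j; apply/eqP/negPn/negP => ?; apply: h; exists j.
  have [T TE] := additive_of (fun x y => congr1 (@^~ j) (tD (r k) x y)).
  have TMz x m : T (x *~ m) = T x * m by rewrite raddfMz -mulrzz.
  have : T (\sum_(i < size s) s`_i *~ c`_i) = 0 by rewrite s0 raddf0.
  rewrite raddf_sum (bigD1 k) //= big1 => [|l /negPf lk].
    rewrite addr0 TMz TE (rE k) //.
    by move/eqP; rewrite mulf_eq0 (negPf tj) (negPf ck).
  rewrite TMz; have [->|cl] := eqVneq c`_l 0; first by rewrite mulr0.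
  have rlk : (r l < r k)%N.
    rewrite ltn_neqAle (kmax _ cl : r l <= r k)%N andbT; apply/eqP => /rinj h.
    by move: lk; rewrite -val_eqE /= h ?eqxx.
  by rewrite (rE l) // TE (tle _ _ _ rlk) ?mul0r.
move=> x Fx; have [n gn] := gsurj x Fx.
have tx : t n.+1 x = 0 by have [_ h _ _] := bP n; rewrite -gn.
have [c ->] := gen _ _ Fx tx.
pose idx := [seq i <- iota 0 n.+1 | b i != 0].
exists (map b idx), (map c idx); split; [|split; first by rewrite !size_map].
  move=> y /mapP[i]; rewrite mem_filter => /andP[bi _] ->.
  by split=> //; exists i.
rewrite size_map; transitivity (\sum_(i <- idx) b i *~ c i).
  rewrite big_filter /index_iota subn0 [LHS](bigID (fun i => b i != 0)) /=.
  by rewrite [X in _ + X]big1 ?addr0 // => i /negPn/eqP ->; rewrite mul0rz.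
rewrite (big_nth 0%N) big_mkord; apply: eq_bigr => i _.
by rewrite !(nth_map 0%N).
Qed.

(** * Countable unions and finitely supported sequences *)

Lemma countable_bigcup (I T : Type) (C : I -> Prop) (S : I -> T -> Prop) :
  countable_set C -> (forall i, C i -> countable_set (S i)) ->
  countable_set (fun x => exists2 i, C i & S i x).
Proof.
move=> [c ci] Sc.
have /choice[d dP] : forall i, exists f : T -> nat,
    C i -> forall x y, S i x -> S i y -> f x = f y -> x = y.
  move=> i; have [/Sc[f fi]|nC] := pselect (C i); first by exists f.
  by exists (fun=> 0%N).
have /choice[a aP] : forall x, exists oi : option I,
    (exists2 i, C i & S i x) -> if oi is Some i then C i /\ S i x else False.
  move=> x; have [[i Ci Si]|nS] := pselect (exists2 i, C i & S i x).
    by exists (Some i).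
  by exists None.
exists (fun x => if a x is Some i then pickle (c i, d i x) else 0%N) => x y Sx Sy.
have := aP x Sx; have := aP y Sy; case: (a x) => [i|//]; case: (a y) => [j|//].
move=> [Cj Sj] [Ci Si] /(pcan_inj pickleK)[/(ci _ _ Ci Cj) ij]; subst j.
exact: dP.
Qed.

Lemma countable_set1 (T : Type) (x : T) : countable_set (fun y => y = x).
Proof. by exists (fun=> 0%N) => y z -> ->. Qed.

Lemma countable_setU (T : Type) (S S' : T -> Prop) :
  countable_set S -> countable_set S' -> countable_set (fun x => S x \/ S' x).
Proof.
move=> Sc Sc'; apply: (@countable_sub _ _ (fun x => exists2 b : bool, True & if b then S x else S' x)).
  by move=> x [Sx|Sx]; [exists true|exists false].
by apply: (countable_bigcup (countType_countable _)) => -[].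
Qed.

Lemma countable_finsupp (H : zmodType) : countable_set (fun _ : H => True) ->
  countable_set (fun u : nat -> H => exists n, forall k, (n <= k)%N -> u k = 0).
Proof.
move=> [c ci]; apply: (@countable_sub _ _
    (fun u => exists2 n, True & forall k, (n <= k)%N -> u k = 0)).
  by move=> u [n un]; exists n.
apply: (countable_bigcup (countType_countable _)) => n _.
exists (fun u => pickle [seq c (u k) | k <- iota 0 n]) => u w un wn.
move=> /(pcan_inj pickleK)/eq_in_map e; apply/funext => k.
have [kn|nk] := ltnP k n; last by rewrite un ?wn.
by apply: ci => //; apply: e; rewrite mem_iota.
Qed.

(** * Subgroups as groups, cardinality aleph_1, induced isomorphisms *)

Definition subgroup_type (U : zmodType) (P : U -> Prop) (hP : is_subgroup P) :=
  {x : U | P x}.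

Section SubgroupType.
Variables (U : zmodType) (P : U -> Prop) (hP : is_subgroup P).
Local Notation T := (subgroup_type hP).

HB.instance Definition _ := gen_eqMixin T.
HB.instance Definition _ := gen_choiceMixin T.

Let zero : T := exist _ 0 hP.1.
Let add (x y : T) : T := exist _ (sval x + sval y) (subgroupD hP (svalP x) (svalP y)).
Let opp (x : T) : T := exist _ (- sval x) (subgroupN hP (svalP x)).

Lemma sval_subgroup_inj : injective (sval : T -> U).
Proof.
by case=> x Px [y Py] /= e; subst y; congr exist; apply: Prop_irrelevance.
Qed.

Let addA : associative add.
Proof. by move=> x y z; apply: sval_subgroup_inj; rewrite /= addrA. Qed.
Let addC : commutative add.
Proof. by move=> x y; apply: sval_subgroup_inj; rewrite /= addrC. Qed.
Let add0 : left_id zero add.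
Proof. by move=> x; apply: sval_subgroup_inj; rewrite /= add0r. Qed.
Let addN : left_inverse zero opp add.
Proof. by move=> x; apply: sval_subgroup_inj; rewrite /= addNr. Qed.

HB.instance Definition _ := GRing.isZmodule.Build T addA addC add0 addN.

End SubgroupType.

Lemma subgroup_zmodType (U : zmodType) (P : U -> Prop) : is_subgroup P ->
  exists (G : zmodType) (v : {additive G -> U}),
    injective v /\ forall x, P x <-> exists g, v g = x.
Proof.
move=> hP; have sD : {morph (sval : subgroup_type hP -> U) : x y / x + y} by [].
have [v vE] := additive_of sD.
exists (subgroup_type hP), v; split=> [x y|x].
  by rewrite !vE => /sval_subgroup_inj.
split=> [Px|[g <-]]; first by exists (exist _ x Px); rewrite vE.
by rewrite vE; apply: svalP.
Qed.

(** Order [T] lexicographically, first by a rank [r x] with [x] in [V (r x)], then by a numbering of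
    [V (r x)]. A proper segment lies in a union of countably many sets [V a]. *)
Lemma card_aleph1_filtration (W T : Type) (lt : W -> W -> Prop) (V : W -> T -> Prop) :
  (forall x, ~ lt x x) -> (forall x y z, lt x y -> lt y z -> lt x z) ->
  (forall x y, x <> y -> lt x y \/ lt y x) -> well_founded lt ->
  (forall x, countable_set (fun y => lt y x)) ->
  (forall a, countable_set (V a)) -> (forall x, exists a, V a x) ->
  ~ countable_set (fun _ : T => True) -> card_aleph1 T.
Proof.
move=> irr tr tot wf ic Vc Vex unc; split=> //.
have /choice[r rP] := Vex; have /choice[c ci] := Vc.
pose R x y := lt (r x) (r y) \/ r x = r y /\ (c (r x) x < c (r y) y)%N.
exists R; split; [|split; [|split; [|split]]].
- by move=> x [/irr //|[_]]; rewrite ltnn.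
- move=> x y z [xy|[xy cxy]] [yz|[yz cyz]].
  + by left; apply: tr yz.
  + by left; rewrite -yz.
  + by left; rewrite xy.
  + by right; split; [rewrite xy|apply: ltn_trans cyz].
- move=> x y xy; have [e|/tot[]] := pselect (r x = r y); last 2 first.
  + by left; left.
  + by right; left.
  case: (ltngtP (c (r x) x) (c (r y) y)) => h.
  + by left; right.
  + by right; right.
  + by case: xy; apply: (ci (r y)) => //; rewrite -e // {2}e.
- suff h a : forall n x, a = r x -> (c (r x) x < n)%N -> Acc R x.
    by move=> x; apply: (h (r x) (c (r x) x).+1).
  elim: (wf a) => {}a _ IHa; elim=> [|n IHn] x ax; first by rewrite ltn0.
  rewrite ltnS => cn; constructor=> y [yx|[yx cyx]].
    by apply: (IHa (r y) _ (c (r y) y).+1) => //; rewrite ax.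
  by apply: IHn; [rewrite yx|apply: leq_trans cn].
- move=> x; apply: (@countable_sub _ _
      (fun y => exists2 a, lt a (r x) \/ a = r x & V a y)).
    by move=> y [yx|[yx _]]; exists (r y) => //; [left|right].
  apply: countable_bigcup => //; apply: countable_setU => //.
  exact: countable_set1.
Qed.

(* A correspondence [R] induces an isomorphism from a quotient of its domain onto [P]. *)
Lemma induced_iso (A B P Q : zmodType) (R : A -> P -> Prop) (S : B -> Q -> Prop)
    (phi : {additive A -> B}) (psi : {additive B -> A}) :
  (forall x y h h', R x h -> R y h' -> R (x - y) (h - h')) ->
  (forall x y h h', S x h -> S y h' -> S (x - y) (h - h')) ->
  (forall x h h', R x h -> R x h' -> h = h') ->
  (forall x h h', S x h -> S x h' -> h = h') ->
  (forall h, exists x, R x h) -> (forall h, exists y, S y h) ->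
  cancel phi psi -> cancel psi phi ->
  (forall x h, R x h -> exists h', S (phi x) h') -> (forall x, R x 0 -> S (phi x) 0) ->
  (forall y h, S y h -> exists h', R (psi y) h') -> (forall y, S y 0 -> R (psi y) 0) ->
  group_iso P Q.
Proof.
move=> RB SB Ru Su Rl Sl phiK psiK phiR phi0 psiS psi0.
have [x0 R0] := Rl 0.
have /choice[l lR] := Rl; have /choice[f fS] := fun h => phiR _ _ (lR h).
have /choice[l' lS] := Sl; have /choice[g gR] := fun h => psiS _ _ (lS h).
(* The value of [f] does not depend on the lift: two lifts of [h] differ by a lift of 0, and [phi]
   sends lifts of 0 to lifts of 0. *)
have fE x h h' : R x h -> S (phi x) h' -> f h = h'.
  move=> xh xh'; have xl : R (x - l h) 0 by rewrite -(subrr h); apply: RB.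
  have := SB _ _ _ _ xh' (phi0 _ xl).
  by rewrite -raddfB subKr subr0 => /(Su _ _ _ (fS h)).
have gE y h h' : S y h -> R (psi y) h' -> g h = h'.
  move=> yh yh'; have yl : S (y - l' h) 0 by rewrite -(subrr h); apply: SB.
  have := RB _ _ _ _ yh' (psi0 _ yl).
  by rewrite -raddfB subKr subr0 => /(Ru _ _ _ (gR h)).
exists f; split.
  have fB h h' : f (h - h') = f h - f h'.
    by apply: (@fE (l h - l h')); [apply: RB|rewrite raddfB; apply: SB].
  have f0 : f 0 = 0 by rewrite -(subrr 0) fB subrr.
  by move=> h h'; rewrite -{1}[h']opprK fB -[- h']sub0r fB f0 sub0r opprK.
exists g => h.
  by apply: (@gE (phi (l h))); [apply: fS|rewrite phiK].
by apply: (@fE (psi (l' h))); [apply: gR|rewrite psiK].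
Qed.

Lemma group_iso_additive (A B : zmodType) : group_iso A B ->
  exists (f : {additive A -> B}) (g : {additive B -> A}), cancel f g /\ cancel g f.
Proof.
move=> [f [fD [g fK gK]]]; have [F FE] := additive_of fD.
have [G GE] : exists G : {additive B -> A}, G =1 g.
  by apply: additive_of => x y; apply: (can_inj fK); rewrite fD !gK.
by exists F, G; split=> x; rewrite GE FE.
Qed.

(** * Functions with germs along ladders *)

Section Omega1.
Variables (W : Type) (lt : W -> W -> Prop).
Hypothesis lt_irr : forall x, ~ lt x x.
Hypothesis lt_tr : forall x y z, lt x y -> lt y z -> lt x z.
Hypothesis lt_tot : forall x y, x <> y -> lt x y \/ lt y x.
Hypothesis lt_wf : well_founded lt.
Hypothesis lt_c : forall x, countable_set (fun y => lt y x).
Hypothesis W_unc : ~ countable_set (fun _ : W => True).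

Variable lad : W -> nat -> W.
Hypothesis lad_lt : forall d, is_limit lt d -> forall k, lt (lad d k) d.
Hypothesis lad_cof : forall d, is_limit lt d -> forall g, lt g d ->
  exists n, forall k, (n <= k)%N -> lt g (lad d k).

Lemma lt_asym x y : lt x y -> ~ lt y x.
Proof. by move=> xy /(lt_tr xy)/lt_irr. Qed.

Lemma le_lt_tr x y z : ~ lt y x -> lt y z -> lt x z.
Proof.
move=> nyx yz; have [->//|/lt_tot[xy|//]] := pselect (x = y).
exact: lt_tr xy yz.
Qed.

Lemma lt_le_tr x y z : lt x y -> ~ lt z y -> lt x z.
Proof.
move=> xy nzy; have [<-//|/lt_tot[h|//]] := pselect (y = z).
exact: lt_tr xy h.
Qed.

(** Uncountable cofinality: an unbounded countable family would cover [W] by countably many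
    segments, each countable even with its end point added. *)
Lemma countable_bounded (I : Type) (C : I -> Prop) (a : I -> W) : countable_set C ->
  exists d, forall i, C i -> lt (a i) d.
Proof.
move=> Cc; apply: contrapT => /forallNP h; apply: W_unc.
apply: (@countable_sub _ _ (fun d => exists2 i, C i & lt d (a i) \/ d = a i)).
  move=> d _; have /existsNP[i /not_implyP[Ci nd]] := h d; exists i => //.
  by have [->|/lt_tot[]] := pselect (d = a i); [right|left|].
apply: countable_bigcup => // i _; apply: countable_setU => //.
exact: countable_set1.
Qed.

(** Serves to pass beyond finitely many rungs of a ladder while staying below [d]. *)
Lemma limit_bound d (l : nat -> W) n : is_limit lt d ->
  exists2 g, lt g d & forall k, (k < n)%N -> lt (l k) d -> lt (l k) g.
Proof.
move=> [[b bd] lim]; elim: n => [|n [g gd gP]]; first by exists b.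
have [lnd|nlnd] := pselect (lt (l n) d); last first.
  by exists g => // k; rewrite ltnS leq_eqVlt => /predU1P[->|/gP].
have [g' gg' g'd] := lim _ gd; have [l' ll' l'd] := lim _ lnd.
have [lg|lg] := pselect (lt g' l').
  exists l' => // k; rewrite ltnS leq_eqVlt => /predU1P[-> //|/gP h] /h kg.
  exact/(lt_tr kg)/(lt_tr gg').
exists g' => // k; rewrite ltnS leq_eqVlt => /predU1P[-> _|/gP h /h kg].
  exact: lt_le_tr lg.
exact: lt_tr kg gg'.
Qed.

Variables (H : zmodType) (Hn : nat -> H -> Prop).
Hypothesis H_c : countable_set (fun _ : H => True).
Hypothesis Hn_sub : forall k, is_subgroup (Hn k).
Hypothesis Hn_mon : forall k l h, (k <= l)%N -> Hn k h -> Hn l h.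
Hypothesis Hn_ex : forall h, exists k, Hn k h.

Local Notation fn := (W -> nat -> H).

Definition vanishes_from (a : W) (f : fn) := forall b, ~ lt b a -> forall k, f b k = 0.

Definition germ (d : W) (f : fn) (h : H) := exists2 g, lt g d &
  forall b k, lt b d -> ~ lt b g -> f b k = if `[< b = lad d k >] then h else 0.

(* The germ at [d] is the eventual value of [f] along the ladder of [d]. The [k]-th rung
   may only carry values from [Hn k], so all values are taken in free groups although
   the germs exhaust [H]. *)
Definition ladder_fn (f : fn) :=
  [/\ forall b k, Hn k (f b k), forall b, exists n, forall k, (n <= k)%N -> f b k = 0,
      exists a, vanishes_from a f & forall d, is_limit lt d -> exists h, germ d f h].

Definition restr (a : W) (f : fn) : fn :=
  fun b k => if `[< lt b a >] then f b k else 0.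

Definition lift (d : W) (n : nat) (h : H) : fn :=
  fun b k => if `[< b = lad d k >] && (n <= k)%N then h else 0.

Definition single (b0 : W) (k0 : nat) (h : H) : fn :=
  fun b k => if `[< b = b0 >] && (k == k0) then h else 0.

Lemma fnB (f g : fn) b k : (f - g) b k = f b k - g b k. Proof. by []. Qed.
Lemma fnD (f g : fn) b k : (f + g) b k = f b k + g b k. Proof. by []. Qed.
Lemma fnMn (f : fn) n b k : (f *+ n) b k = f b k *+ n.
Proof. by elim: n => // n IH; rewrite !mulrS fnD IH. Qed.

Lemma vanishes_from_le a a' f : vanishes_from a f -> lt a a' -> vanishes_from a' f.
Proof. by move=> fa aa' b ba' k; apply: fa => ba; apply/ba'/(lt_tr ba). Qed.

Lemma Hn0 k : Hn k 0. Proof. by have [] := Hn_sub k. Qed.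

Lemma lt_ub x y d : lt x d -> lt y d -> exists2 z, lt z d & ~ lt z x /\ ~ lt z y.
Proof.
move=> xd yd; have [xy|xy] := pselect (lt x y); last by exists x => //; split=> // /lt_irr.
by exists y => //; split; [apply: lt_asym|apply: lt_irr].
Qed.

Lemma germB d f f' h h' : germ d f h -> germ d f' h' -> germ d (f - f') (h - h').
Proof.
move=> [g gd fP] [g' g'd f'P]; have [z zd [zg zg']] := lt_ub gd g'd.
exists z => // b k bd bz; rewrite fnB fP ?f'P //.
- by case: ifP; rewrite ?subrr.
- by move=> bg'; apply: bz; apply: (lt_le_tr bg').
- by move=> bg; apply: bz; apply: (lt_le_tr bg).
Qed.

Lemma germ0 d : is_limit lt d -> germ d 0 0.
Proof. by move=> [[b bd] _]; exists b => // *; case: ifP. Qed.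

Lemma germ_uniq d f h h' : is_limit lt d -> germ d f h -> germ d f h' -> h = h'.
Proof.
move=> dl [g gd fP] [g' g'd f'P]; have [z zd [zg zg']] := lt_ub gd g'd.
have [n /(_ n (leqnn _)) zn] := lad_cof dl zd.
have ng : ~ lt (lad d n) g by move=> h0; apply/zg/(lt_tr zn).
have ng' : ~ lt (lad d n) g' by move=> h0; apply/zg'/(lt_tr zn).
have := fP _ n (lad_lt dl n) ng; rewrite (f'P _ n (lad_lt dl n) ng').
by rewrite asboolT.
Qed.

Lemma germ_vanishes d f g : lt g d -> vanishes_from g f -> germ d f 0.
Proof. by move=> gd fg; exists g => // b k _ bg; rewrite fg ?if_same. Qed.

Lemma germ0_vanishes d f : vanishes_from d f -> germ d f 0 ->
  exists2 g, lt g d & vanishes_from g f.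
Proof.
move=> fd [g gd fP]; exists g => // b bg k.
by have [bd|bd] := pselect (lt b d); [rewrite fP ?if_same|apply: fd].
Qed.

Lemma ladder_fn_sub : is_subgroup ladder_fn.
Proof.
split.
  split=> [b k|b||d dl]; [exact: Hn0|by exists 0%N| |by exists 0; apply: germ0].
  suff [a _] : exists a : W, True by exists a.
  by apply: contrapT => h; apply: W_unc; exists (fun=> 0%N) => x; case: h; exists x.
move=> x y [xH xf [a xa] xg] [yH yf [a' ya] yg]; split.
- by move=> b k; apply: (Hn_sub k).2.
- move=> b; have [n xn] := xf b; have [m ym] := yf b; exists (n + m)%N => k nk.
  by rewrite fnB xn ?ym ?subrr //; lia.
- have [aa'|aa'] := pselect (lt a a').
    exists a' => b ba' k; rewrite fnB ya // (vanishes_from_le xa aa') //.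
    by rewrite subrr.
  exists a => b ba k; rewrite fnB xa // ya ?subrr // => ba'; apply: ba.
  exact: lt_le_tr aa'.
- move=> d dl; have [h xh] := xg d dl; have [h' yh] := yg d dl.
  by exists (h - h'); apply: germB.
Qed.

(** This truncation is the projection that splits off an initial segment. Limits above [a] get germ
    0; at the other limits the germ is unchanged. *)
Lemma restr_ladder_fn a f : ladder_fn f -> ladder_fn (restr a f).
Proof.
move=> [fH ff _ fg]; split.
- by move=> b k; rewrite /restr; case: asboolP => // _; apply: Hn0.
- by move=> b; have [n fn_] := ff b; exists n => k /fn_; rewrite /restr; case: asboolP.
- by exists a => b ba k; rewrite /restr asboolF.
move=> d dl; have [ad|ad] := pselect (lt a d).
  exists 0; apply: (@germ_vanishes d _ a) => // b ba k.
  by rewrite /restr asboolF.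
have [h [g gd gP]] := fg d dl; exists h; exists g => // b k bd bg.
by rewrite /restr asboolT ?gP //; apply: lt_le_tr ad.
Qed.

(** Starting at rung [n] keeps the value [h] admissible. At a limit below [d] the germ is 0, because
    only finitely many rungs of [d] lie below it; at a limit above [d] the function has already died
    out. *)
Lemma lift_ladder_fn d n h : is_limit lt d -> Hn n h ->
  [/\ ladder_fn (lift d n h), vanishes_from d (lift d n h) & germ d (lift d n h) h].
Proof.
move=> dl hn.
have vd : vanishes_from d (lift d n h).
  by move=> b bd k; rewrite /lift asboolF //= => be; apply: bd; rewrite be; apply: lad_lt.
have gd : germ d (lift d n h) h.
  have [g gd gP] := limit_bound (lad d) n dl; exists g => // b k bd bg.
  rewrite /lift; case: asboolP => // be; rewrite leqNgt; case: ltnP => // kn.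
  by case: bg; rewrite be; apply: gP => //; rewrite -be.
split=> //; split.
- move=> b k; rewrite /lift; case: asboolP => _; last exact: Hn0.
  by case: ifP => [/= nk|_]; [apply: Hn_mon hn|apply: Hn0].
- move=> b; have [bd|bd] := pselect (lt b d); last by exists 0%N => k _; apply: vd.
  have [m mP] := lad_cof dl bd; exists m => k mk.
  rewrite /lift asboolF //= => be.
  by apply: (@lt_irr b); rewrite {2}be; apply: mP.
- by exists d.
move=> d' d'l; have [->|/lt_tot[d'd|dd']] := pselect (d' = d); first by exists h.
  have [m mP] := lad_cof dl d'd.
  have [g gd' gP] := limit_bound (lad d) m d'l.
  exists 0; exists g => // b k bd' bg; rewrite if_same /lift asboolF //= => be.
  have [mk|km] := leqP m k; first by apply: (lt_asym bd'); rewrite be; apply: mP.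
  by apply: bg; rewrite be; apply: gP; rewrite -?be.
by exists 0; apply: (@germ_vanishes d' _ d).
Qed.

Lemma single_ladder_fn b k h : Hn k h -> ladder_fn (single b k h).
Proof.
move=> hk.
have [d bd] := countable_bounded (fun=> b) (countType_countable (fun _ : unit => True)).
have {}bd := bd tt I.
have vd a : lt b a -> vanishes_from a (single b k h).
  by move=> ba b' b'a k'; rewrite /single asboolF //= => e; apply: b'a; rewrite e.
split.
- move=> b' k'; rewrite /single; case: asboolP => _; last exact: Hn0.
  by case: eqP => [->|_] //; apply: Hn0.
- move=> b'; exists k.+1 => k' k'k; rewrite /single.
  by rewrite (gtn_eqF k'k) andbF.
- by exists d; apply: vd.
move=> d' [[c cd'] lim]; exists 0.
have [bd'|bd'] := pselect (lt b d').
  by have [g bg gd'] := lim _ bd'; apply: (germ_vanishes gd'); apply: vd.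
exists c => // b' k' b'd' _; rewrite if_same /single asboolF //= => e.
by apply: bd'; rewrite -e.
Qed.

(** Transfinite induction on [a]. At a limit, [f] is recovered from a restriction to some [g] below
    [a] and the germ at [a]; at a successor of [c'], from its restriction to [c'] and the finitely
    supported sequence [f c']; at the least point only 0 remains. *)
Lemma countable_vanishing a :
  countable_set (fun f => ladder_fn f /\ vanishes_from a f).
Proof.
elim: (lt_wf a) => {}a _ IH.
have [al|nal] := pselect (is_limit lt a).
  apply: (@countable_sub _ _ (fun f => exists2 g, lt g a & exists2 h, True &
      ladder_fn f /\ vanishes_from a f /\
      forall b k, lt b a -> ~ lt b g -> f b k = if `[< b = lad a k >] then h else 0)).
    move=> f [fM fa]; have [_ _ _ /(_ _ al)[h [g ga gP]]] := fM.
    by exists g => //; exists h.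
  apply: countable_bigcup => // g ga; apply: countable_bigcup => // h _.
  pose F (f : fn) b k := if `[< lt b g >] then f b k else
    if `[< lt b a >] && `[< b = lad a k >] then h else 0.
  apply: (@countable_image _ _ _ _ F (IH g ga)) => f [fM [fa fP]].
  exists (restr g f); first split; first exact: restr_ladder_fn.
    by move=> b bg k; rewrite /restr asboolF.
  apply/funext => b; apply/funext => k; rewrite /F /restr.
  case: asboolP => // bg; case: asboolP => [ba|ba]; first by rewrite fP.
  by rewrite fa.
have [[c ca]|nc] := pselect (exists c, lt c a); last first.
  apply: (countable_sub _ (countable_set1 (0 : fn))) => f [_ fa].
  apply/funext => b; apply/funext => k; apply: fa => ba; apply: nc.
  by exists b.
have [c' c'a c'P] : exists2 c, lt c a & forall b, lt b a -> ~ lt c b.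
  apply: contrapT => h; apply: nal; split; first by exists c.
  move=> b ba; apply: contrapT => h'; apply: h; exists b => // b' b'a bb'.
  by apply: h'; exists b'.
apply: (@countable_sub _ _ (fun f => exists2 u : nat -> H,
    (exists n, forall k, (n <= k)%N -> u k = 0) &
    ladder_fn f /\ vanishes_from a f /\ f c' = u)).
  by move=> f [fM fa]; exists (f c') => //; have [_ ff _ _] := fM; apply: ff.
apply: (countable_bigcup (countable_finsupp H_c)) => u _.
pose F (f : fn) b k := if `[< lt b c' >] then f b k else if `[< b = c' >] then u k else 0.
apply: (@countable_image _ _ _ _ F (IH c' c'a)) => f [fM [fa fu]].
exists (restr c' f); first split; first exact: restr_ladder_fn.
  by move=> b bg k; rewrite /restr asboolF.
apply/funext => b; apply/funext => k; rewrite /F /restr.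
case: asboolP => // bc; case: asboolP => [->|nbc]; first by rewrite fu.
by rewrite fa // => /c'P; case/lt_tot: nbc.
Qed.


(** * The group of ladder functions: separability and cardinality *)

Variables (Idx : Type) (e : nat -> H -> Idx -> int).
Hypothesis eD : forall k x y, Hn k x -> Hn k y -> e k (x + y) = e k x + e k y.
Hypothesis e_inj : forall k x, Hn k x -> e k x = 0 -> x = 0.
Variables (M : zmodType) (v : {additive M -> fn}).
Hypothesis v_inj : injective v.
Hypothesis vP : forall f, ladder_fn f <-> exists x, v x = f.

Lemma v_ladder_fn x : ladder_fn (v x). Proof. by apply/vP; exists x. Qed.

Lemma countable_vanishing_M a : countable_set (fun x => vanishes_from a (v x)).
Proof.
have [c ci] := countable_vanishing a; exists (c \o v) => x y xa ya /= /ci h.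
by apply/v_inj/h; split=> //; apply: v_ladder_fn.
Qed.

Lemma vanishing_M x : exists a, vanishes_from a (v x).
Proof. by have [_ _ []] := v_ladder_fn x; last by move=> a; exists a. Qed.

(** Choose [a] beyond the supports of all members of [S]. The functions vanishing from [a] on form
    the summand and those vanishing below [a] the complement. Freeness follows from
    [countable_free], with the integer coordinates [e k] of all values as the embedding. *)
Lemma ladder_aleph1_separable : aleph1_separable M.
Proof.
have /choice[b bP] := vanishing_M.
move=> S Sc; have [a aP] := countable_bounded b Sc.
have Fs : is_subgroup (fun x => vanishes_from a (v x)).
  split=> [c _ k|x y xa ya c ca k]; first by rewrite raddf0.
  by rewrite raddfB fnB xa ?ya ?subrr.
exists (fun x => vanishes_from a (v x)); split; first exact: countable_vanishing_M.
split; [|split; [split=> //|by move=> x /aP ba; apply: vanishes_from_le (bP x) ba]].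
  pose E x (i : W * nat * Idx) := e i.1.2 (v x i.1.1 i.1.2) i.2.
  apply: (@countable_free _ _ _ E) => //; last 1 first.
  - move=> x _ Ex; apply: v_inj; rewrite raddf0; apply/funext => c; apply/funext => k.
    have [xH _ _ _] := v_ladder_fn x; apply: e_inj (xH c k) _.
    by apply/funext => i; rewrite -[RHS](congr1 (@^~ (c, k, i)) Ex).
  - move=> x y; apply/funext => -[[c k] i].
    have [xH _ _ _] := v_ladder_fn x; have [yH _ _ _] := v_ladder_fn y.
    by rewrite /E /= raddfD fnD eD.
  - exact: countable_vanishing_M.
exists (fun x => forall c, lt c a -> forall k, v x c k = 0); split; [|split].
- split=> [c _ k|x y xa ya c ca k]; first by rewrite raddf0.
  by rewrite raddfB fnB xa ?ya ?subrr.
- move=> x xa xa'; apply: v_inj; rewrite raddf0; apply/funext => c; apply/funext => k.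
  by have [ca|ca] := pselect (lt c a); [apply: xa'|apply: xa].
move=> x; have /vP[y vy] := restr_ladder_fn a (v_ladder_fn x).
exists y, (x - y); split; [|split; last by rewrite addrC subrK].
  by move=> c ca k; rewrite vy /restr asboolF.
by move=> c ca k; rewrite raddfB fnB vy /restr asboolT ?subrr.
Qed.

(** The sets of functions vanishing from [a] on filter [M] by countable pieces, while the one-point
    functions with value [h0] inject [W] into [M]. *)
Lemma ladder_card_aleph1 h0 : h0 != 0 :> H -> card_aleph1 M.
Proof.
move=> h0n; apply: (@card_aleph1_filtration W M lt (fun a x => vanishes_from a (v x))) => //.
- exact: countable_vanishing_M.
- exact: vanishing_M.
move=> [c ci]; apply: W_unc; have [k hk] := Hn_ex h0.
have /choice[s sP] : forall b, exists x, v x = single b k h0.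
  by move=> b; apply/vP; apply: single_ladder_fn.
exists (fun b => c (s b)) => b b' _ _ /ci - /(_ I I) sb.
have := sP b; rewrite sb sP => /(congr1 (fun f => f b k)).
rewrite /single eqxx [`[< b = b >]]asboolT //= andbT.
by case: asboolP => // _ /eqP; rewrite 1?eq_sym (negPf h0n).
Qed.

(** * Supports of rows over [M] and closure points of a pair of maps *)

Definition row_vanishes (m : nat) (a : W) (x : 'rV[M]_m) :=
  forall j, vanishes_from a (v (x 0 j)).

Lemma lt_ub_ex a b : exists2 c, lt a c & lt b c.
Proof.
have [c cP] := countable_bounded (fun i : bool => if i then a else b)
  (countType_countable (fun _ => True)).
by exists c; [apply: (cP true)|apply: (cP false)].
Qed.

Lemma finite_bound m (P : 'I_m -> W -> Prop) d : (exists a, lt a d) ->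
  (forall j a a', P j a -> lt a a' -> P j a') ->
  (forall j, exists2 a, lt a d & P j a) -> exists2 a, lt a d & forall j, P j a.
Proof.
move=> [a0 a0d] Pm Pex.
suff [a ad aP] : exists2 a, lt a d & forall j, j \in enum 'I_m -> P j a.
  by exists a => // j; apply: aP; rewrite mem_enum.
elim: (enum _) => [|i s [a ad aP]]; first by exists a0.
have [b bd bP] := Pex i.
have [z zd [za zb]] := lt_ub ad bd.
have Pz j c : ~ lt z c -> P j c -> P j z.
  by move=> zc Pjc; have [->//|/lt_tot[//|cz]] := pselect (z = c); apply: Pm cz.
by exists z => // j; rewrite inE => /predU1P[->|/aP]; [exact: Pz zb bP|exact: Pz za].
Qed.

Lemma row_vanishes_ex m (x : 'rV[M]_m) : exists a, row_vanishes a x.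
Proof.
have /choice[b bP] := vanishing_M.
have [a aP] := countable_bounded (fun j => b (x 0 j)) (countType_countable (fun _ => True)).
by exists a => j; apply: vanishes_from_le (bP _) (aP j I).
Qed.

Lemma row_vanishes_le m a a' (x : 'rV[M]_m) :
  row_vanishes a x -> lt a a' -> row_vanishes a' x.
Proof. by move=> xa aa' j; apply: vanishes_from_le aa'. Qed.

Lemma row_vanishesB m a (x y : 'rV[M]_m) :
  row_vanishes a x -> row_vanishes a y -> row_vanishes a (x - y).
Proof.
move=> xa ya j b ba k; rewrite mxE raddfD fnD mxE raddfN.
by rewrite -[(- v _) b k]/(- (v _ b k)) xa ?ya ?subrr.
Qed.

Lemma countable_row_vanishes m a : countable_set (@row_vanishes m a).
Proof.
have [c ci] := countable_vanishing_M a.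
exists (fun x => pickle (map_mx c x)) => x y xa ya /(pcan_inj pickleK)/matrixP h.
apply/rowP => j; apply: ci; [exact: xa|exact: ya|].
by have := h 0 j; rewrite !mxE.
Qed.

(** Only countably many rows vanish from [a] on, so the supports of their images have a common
    bound. *)
Lemma row_map_bound m n (phi : 'rV[M]_m -> 'rV[M]_n) a :
  exists b, forall x, row_vanishes a x -> row_vanishes b (phi x).
Proof.
have /choice[r rP] := @row_vanishes_ex n.
have [b bP] := countable_bounded (r \o phi) (@countable_row_vanishes m a).
by exists b => x xa; apply: row_vanishes_le (rP _) (bP _ xa).
Qed.

(** Closing off: [B] bounds the effect of both maps, and [d] is the supremum of the iterates of [B],
    a limit because [B] strictly increases. *)
Lemma closure_point m n (phi : 'rV[M]_m -> 'rV[M]_n) (psi : 'rV[M]_n -> 'rV[M]_m) :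
  exists d, [/\ is_limit lt d,
    forall g, lt g d -> exists2 g', lt g' d &
      forall x, row_vanishes g x -> row_vanishes g' (phi x) &
    forall g, lt g d -> exists2 g', lt g' d &
      forall x, row_vanishes g x -> row_vanishes g' (psi x)].
Proof.
have /choice[B BP] : forall a, exists b, [/\ lt a b,
    forall x, row_vanishes a x -> row_vanishes b (phi x) &
    forall x, row_vanishes a x -> row_vanishes b (psi x)].
  move=> a; have [b1 b1P] := row_map_bound phi a; have [b2 b2P] := row_map_bound psi a.
  have [c b1c b2c] := lt_ub_ex b1 b2; have [c' cc' ac'] := lt_ub_ex c a.
  exists c'; split=> // x xa.
    by apply/(row_vanishes_le _ cc')/(row_vanishes_le _ b1c)/b1P.
  by apply/(row_vanishes_le _ cc')/(row_vanishes_le _ b2c)/b2P.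
have [a0 _] : exists a : W, True.
  by apply: contrapT => h; apply: W_unc; exists (fun=> 0%N) => x; case: h; exists x.
pose a i := iter i B a0.
have [u uP] := countable_bounded a (countType_countable (fun _ => True)).
have [d dP dmin] : exists2 d, (forall i, lt (a i) d) &
    forall b, (forall i, lt (a i) b) -> ~ lt b d.
  apply: contrapT => h; suff : forall b, ~ forall i, lt (a i) b.
    by move/(_ u); apply=> i; apply: uP.
  move=> b; elim: (lt_wf b) => {}b _ IH ab; apply: h; exists b => // b' ab' /IH.
  exact.
have below b : lt b d -> exists i, lt b (a i).
  move=> bd; have /existsNP[i ni] : ~ forall i, lt (a i) b by move=> /dmin.
  exists i.+1; apply: (le_lt_tr ni); by have [] := BP (a i).
exists d; split.
- split=> [|b /below[i bi]]; first by exists (a 0%N).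
  by exists (a i).
- move=> g /below[i gi]; exists (a i.+1) => // x /row_vanishes_le /(_ gi).
  by have [_ + _] := BP (a i); apply.
- move=> g /below[i gi]; exists (a i.+1) => // x /row_vanishes_le /(_ gi).
  by have [_ _] := BP (a i); apply.
Qed.

(** * Divisibility and the action of additive maps on germs *)

Definition pdivisible (G : zmodType) (p : nat) (x : G) :=
  forall N, exists y, x = y *+ p ^ N.

(** An integer coordinate divisible by [p] to the power of its own absolute value is 0, since that
    power exceeds it. *)
Lemma Hn_reduced k p x : (1 < p)%N ->
  (forall N, exists2 y, Hn k y & x = y *+ p ^ N) -> x = 0.
Proof.
move=> p1 xp; have [y hy xE] := xp 0%N; have hx : Hn k x by rewrite xE mulr1n.
apply: (e_inj hx); apply/funext => i; rewrite -[RHS]/(0 : int).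
have e0 : e k 0 = 0 by apply: (addrI (e k 0)); rewrite -eD ?addr0 //; apply: Hn0.
have hMn z n : Hn k z -> Hn k (z *+ n) /\ e k (z *+ n) = e k z *+ n.
  move=> hz; elim: n => [|n [IH1 IH2]]; first by split=> //; apply: Hn0.
  by rewrite mulrSr; split; [apply: (subgroupD (Hn_sub k))|rewrite eD // IH2 mulrSr].
have [z hz xz] := xp `|e k x i|%N.
have : (p ^ `|e k x i| %| `|e k x i|)%N.
  rewrite {2}xz (hMn z _ hz).2 natmulfctE -mulr_natr natz abszM absz_nat.
  exact: dvdn_mull.
have [/eqP|ex0] := posnP `|e k x i|%N; first by rewrite absz_eq0 => /eqP.
by move=> /(dvdn_leq ex0); rewrite leqNgt ltn_expl.
Qed.

Section Germs.
Variable d : W.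
Hypothesis dl : is_limit lt d.

Definition row_germ m (x : 'rV[M]_m) (h : 'rV[H]_m) :=
  row_vanishes d x /\ forall j, germ d (v (x 0 j)) (h 0 j).

Lemma row_germB m (x y : 'rV[M]_m) h h' :
  row_germ x h -> row_germ y h' -> row_germ (x - y) (h - h').
Proof.
move=> [xd xh] [yd yh]; split=> [|j]; first exact: row_vanishesB.
by rewrite !mxE raddfB; apply: germB.
Qed.

Lemma row_germ00 m : row_germ (0 : 'rV[M]_m) 0.
Proof.
split=> [j b _ k|j]; first by rewrite mxE raddf0.
by rewrite !mxE raddf0; apply: germ0.
Qed.

Lemma row_germD m (x y : 'rV[M]_m) h h' :
  row_germ x h -> row_germ y h' -> row_germ (x + y) (h + h').
Proof.
move=> xh yh; have := row_germB xh (row_germB (row_germ00 m) yh).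
by rewrite !sub0r !opprK.
Qed.

Lemma row_germMn m (x : 'rV[M]_m) h n : row_germ x h -> row_germ (x *+ n) (h *+ n).
Proof.
move=> xh; elim: n => [|n IH]; first exact: row_germ00.
by rewrite !mulrSr; apply: row_germD.
Qed.

Lemma row_germ_uniq m (x : 'rV[M]_m) h h' : row_germ x h -> row_germ x h' -> h = h'.
Proof. by move=> [_ xh] [_ xh']; apply/rowP => j; apply: germ_uniq dl (xh j) (xh' j). Qed.

Lemma row_germ_lift m (h : 'rV[H]_m) : exists x, row_germ x h.
Proof.
have /choice[l lP] : forall j, exists y, vanishes_from d (v y) /\ germ d (v y) (h 0 j).
  move=> j; have [n hn] := Hn_ex (h 0 j).
  by have [/vP[y <-] yd yh] := lift_ladder_fn dl hn; exists y.
by exists (\row_j l j); split=> j; rewrite mxE; have [] := lP j.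
Qed.

(** Identifies the kernel of taking germs with the rows of support bounded below [d], which are
    preserved when [d] is a closure point. *)
Lemma row_germ0 m (x : 'rV[M]_m) :
  row_germ x 0 <-> exists2 g, lt g d & row_vanishes g x.
Proof.
split=> [[xd xh]|[g gd xg]]; last first.
  split=> [|j]; first exact: row_vanishes_le xg gd.
  by rewrite mxE; apply: germ_vanishes gd _; apply: xg.
apply: finite_bound => [|j a a' ja /(vanishes_from_le ja) //|j].
  by have [] := dl.
by apply: germ0_vanishes (xd j) _; have := xh j; rewrite mxE.
Qed.

Hypothesis H_gen : forall h : H, exists2 s : seq H, h = \sum_(z <- s) z &
  forall z, z \in s -> exists2 p, (1 < p)%N & pdivisible p z.

Variables (m n : nat) (phi : {additive 'rV[M]_m -> 'rV[M]_n}).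
Hypothesis phi_d : forall g, lt g d -> exists2 g', lt g' d &
  forall x, row_vanishes g x -> row_vanishes g' (phi x).

Lemma row_germ0_map x : row_germ x 0 -> row_germ (phi x) 0.
Proof.
move=> /row_germ0[g /phi_d[g' g'd gP] xg]; apply/row_germ0; exists g' => //.
exact: gP.
Qed.

(** Write [h] as [p ^ N] times [h'] and lift [h'] to [x']. The difference of [x] and [p ^ N] times
    [x'] has germ 0, so its image vanishes from [d] on. Hence the values of [phi x] there are
    divisible by every [p ^ N] within [Hn k], which is reduced. *)
Lemma row_vanishes_map_pdivisible p x h : (1 < p)%N -> pdivisible p h ->
  row_germ x h -> row_vanishes d (phi x).
Proof.
move=> p1 hp xh j b bd k; apply: (@Hn_reduced k p) => // N.
have [h' hE] := hp N; have [x' x'h] := row_germ_lift h'.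
exists (v (phi x' 0 j) b k); first by have [] := v_ladder_fn (phi x' 0 j).
have : row_germ (x - x' *+ p ^ N) 0.
  by rewrite -(subrr h) {2}hE; apply: row_germB => //; apply: row_germMn.
move=> /row_germ0_map[] /(_ j b bd k) + _.
rewrite raddfB raddfMn !mxE raddfB fnB => /eqP; rewrite subr_eq0 => /eqP ->.
by rewrite mulmxnE raddfMn fnMn.
Qed.

Lemma row_germ_map x h : row_germ x h -> exists h', row_germ (phi x) h'.
Proof.
move=> xh; suff xd : row_vanishes d (phi x).
  have /choice[h' h'P] : forall j, exists h', germ d (v (phi x 0 j)) h'.
    by move=> j; have [_ _ _] := v_ladder_fn (phi x 0 j); apply.
  by exists (\row_j h' j); split=> // j; rewrite mxE.
(* Quantifying over all lifts makes [good] closed under addition, so it suffices to treat rows with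
   one divisible entry. *)
pose good h := forall x, row_germ x h -> row_vanishes d (phi x).
have goodD h1 h2 : good h1 -> good h2 -> good (h1 + h2).
  move=> g1 g2 y yh; have [x1 x1h] := row_germ_lift h1.
  have h2x : row_germ (y - x1) h2 by rewrite -[h2](addrK h1) (addrC h2); apply: row_germB.
  have := row_vanishesB (g2 _ h2x) (row_vanishesB (row_germ00 n).1 (g1 _ x1h)).
  by rewrite sub0r opprK -raddfD subrK.
have good0 : good 0 by move=> y /row_germ0_map[].
suff : good h by apply.
pose row_at j z : 'rV[H]_m := \row_i if i == j then z else 0.
have -> : h = \sum_j row_at j (h 0 j).
  apply/rowP => i; rewrite summxE (bigD1 i) //= mxE eqxx big1 ?addr0 // => j ji.
  by rewrite mxE eq_sym (negPf ji).
apply: (big_ind good) => // j _; have [s -> sP] := H_gen (h 0 j).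
have -> : row_at j (\sum_(z <- s) z) = \sum_(z <- s) row_at j z.
  by apply/rowP => i; rewrite summxE mxE; under [RHS]eq_bigr do rewrite mxE; case: ifP => // _; rewrite big1_eq.
rewrite big_seq; apply: (big_ind good) => // z /sP[p p1 zp].
move=> y; apply: (row_vanishes_map_pdivisible p1) => N; have [t tE] := zp N.
exists (row_at j t); apply/rowP => i; rewrite mulmxnE !mxE.
by case: eqP; rewrite ?mul0rn.
Qed.

End Germs.

Lemma ladder_iso_induced m n :
  (forall h : H, exists2 s : seq H, h = \sum_(z <- s) z &
    forall z, z \in s -> exists2 p, (1 < p)%N & pdivisible p z) ->
  group_iso ('rV[M]_m) ('rV[M]_n) -> group_iso ('rV[H]_m) ('rV[H]_n).
Proof.
move=> H_gen /group_iso_additive[phi [psi [phiK psiK]]].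
have [d [dl phid psid]] := closure_point phi psi.
apply: (@induced_iso _ _ _ _ (@row_germ d m) (@row_germ d n) phi psi) => //.
- by move=> *; apply: row_germB.
- by move=> *; apply: row_germB.
- by move=> *; apply: (row_germ_uniq dl); eassumption.
- by move=> *; apply: (row_germ_uniq dl); eassumption.
- exact: row_germ_lift.
- exact: row_germ_lift.
- exact: row_germ_map.
- exact: row_germ0_map.
- exact: row_germ_map.
- exact: row_germ0_map.
Qed.

Lemma ladder_fn_comp (th : {additive H -> H}) (f : fn) :
  (forall k h, Hn k h -> Hn k (th h)) ->
  ladder_fn f -> ladder_fn (fun b k => th (f b k)).
Proof.
move=> thH [fH ff [a fa] fg]; split.
- by move=> b k; apply: thH.
- by move=> b; have [n fn0] := ff b; exists n => k /fn0 ->; rewrite raddf0.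
- by exists a => b ba k; rewrite fa // raddf0.
move=> d /fg[h [g gd gP]]; exists (th h); exists g => // b k bd bg.
by rewrite gP //; case: ifP; rewrite ?raddf0.
Qed.

(** Maps preserving every [Hn k] act on ladder functions value by value, so the decomposition of [H]
    into [D] copies of itself passes to [M]. *)
Lemma ladder_iso_power D (X Y : 'I_D -> {additive H -> H}) :
  (forall i k h, Hn k h -> Hn k (X i h)) -> (forall i k h, Hn k h -> Hn k (Y i h)) ->
  (forall i j h, Y i (X j h) = if i == j then h else 0) ->
  (forall h, \sum_i X i (Y i h) = h) ->
  group_iso ('rV[M]_1) ('rV[M]_D).
Proof.
move=> XH YH YX XY.
have ext (th : {additive H -> H}) : (forall k h, Hn k h -> Hn k (th h)) ->
    exists t : M -> M, forall x b k, v (t x) b k = th (v x b k).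
  move=> thH; have /choice[t tP] : forall x, exists y, v y = fun b k => th (v x b k).
    by move=> x; apply/vP/ladder_fn_comp => //; apply: v_ladder_fn.
  by exists t => x b k; rewrite tP.
have /choice[x xP] := fun i => ext _ (XH i); have /choice[y yP] := fun i => ext _ (YH i).
have v_sum (F : 'I_D -> M) b k : v (\sum_i F i) b k = \sum_i v (F i) b k.
  by rewrite raddf_sum !fct_sumE.
have vD a c b k : v (a + c) b k = v a b k + v c b k by rewrite raddfD.
have v_ext a c : (forall b k, v a b k = v c b k) -> a = c.
  by move=> h; apply: v_inj; apply/funext => b; apply/funext => k.
exists (fun u : 'rV[M]_1 => \row_i y i (u 0 0)); split.
  move=> u w; apply/rowP => i; rewrite !mxE; apply: v_ext => b k.
  by rewrite yP !vD !yP raddfD.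
exists (fun w : 'rV[M]_D => \row_(j < 1) \sum_i x i (w 0 i)) => u; apply/rowP => i; rewrite !mxE.
  apply: v_ext => b k; rewrite v_sum -[RHS]XY (ord1 i).
  by apply: eq_bigr => j _; rewrite xP mxE yP.
apply: v_ext => b k; rewrite yP v_sum raddf_sum (bigD1 i) //= xP YX eqxx.
by rewrite big1 ?addr0 // => j ji; rewrite xP YX eq_sym (negPf ji).
Qed.
End Omega1.

Lemma ladder_module_exists (H : zmodType) (Hn : nat -> H -> Prop) (Idx : Type)
    (e : nat -> H -> Idx -> int) (D : nat) (X Y : 'I_D -> {additive H -> H}) (h0 : H) :
  countable_set (fun _ : H => True) -> (forall k, is_subgroup (Hn k)) ->
  (forall k l h, (k <= l)%N -> Hn k h -> Hn l h) -> (forall h, exists k, Hn k h) ->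
  (forall k x y, Hn k x -> Hn k y -> e k (x + y) = e k x + e k y) ->
  (forall k x, Hn k x -> e k x = 0 -> x = 0) -> h0 != 0 ->
  (forall h : H, exists2 s : seq H, h = \sum_(z <- s) z &
    forall z, z \in s -> exists2 p, (1 < p)%N & pdivisible p z) ->
  (forall i k h, Hn k h -> Hn k (X i h)) -> (forall i k h, Hn k h -> Hn k (Y i h)) ->
  (forall i j h, Y i (X j h) = if i == j then h else 0) ->
  (forall h, \sum_i X i (Y i h) = h) ->
  exists M : zmodType, [/\ aleph1_separable M, card_aleph1 M,
    group_iso ('rV[M]_1) ('rV[M]_D) & forall m n,
    group_iso ('rV[M]_m) ('rV[M]_n) -> group_iso ('rV[H]_m) ('rV[H]_n)].
Proof.
move=> Hc Hs Hm Hex eD ei h0n Hg XH YH YX XY.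
have [W [lt [irr tr tot wf [lc unc]]]] := omega1_exists.
have /choice[lad ladP] : forall d, exists l : nat -> W, is_limit lt d ->
    (forall k, lt (l k) d) /\ forall g, lt g d -> exists n, forall k, (n <= k)%N -> lt g (l k).
  move=> d; have [dl|nl] := pselect (is_limit lt d); last by exists (fun=> d).
  by have [l lP] := ladder_exists tr tot (lc d) dl; exists l.
have l1 d (dl : is_limit lt d) := (ladP d dl).1.
have l2 d (dl : is_limit lt d) := (ladP d dl).2.
have [M [v [vi vP]]] := subgroup_zmodType (ladder_fn_sub irr tr tot unc lad Hs).
exists M; split.
- exact: (ladder_aleph1_separable tr tot wf lc unc Hc Hs eD ei vi vP).
- exact: (ladder_card_aleph1 irr tr tot wf lc unc Hc Hs Hex vi vP h0n).
- exact: (ladder_iso_power vi vP XH YH YX XY).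
- move=> m n; exact: (ladder_iso_induced irr tr tot wf lc unc l1 l2 Hc Hs Hm Hex eD ei vi vP Hg).
Qed.

(** * The trace on the Leavitt ring *)

Section Leavitt.
Variable r : nat.
Local Notation d := r.+1.

Local Notation mat := (nat -> nat -> rat).

(* [(i, true)] is the isometry x_i : e_q |-> e_(d q + i), [(i, false)] its transpose y_i. *)
Definition letter : Type := ('I_d * bool)%type.

(** Right multiplication by the operator of [l], and [lact] is left multiplication. Both only
    reindex entries, so no infinite sums arise. *)
Definition ract (l : letter) (a : mat) : mat := fun n m =>
  if l.2 then a n (m * d + l.1)%N else if (m %% d == l.1)%N then a n (m %/ d)%N else 0.

Definition lact (l : letter) (a : mat) : mat := fun n m =>
  if l.2 then if (n %% d == l.1)%N then a (n %/ d)%N m else 0 else a (n * d + l.1)%N m.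

Definition mat1 : mat := fun n m => (n == m)%:R.

Definition wact (a : mat) (w : seq letter) := foldl (fun b l => ract l b) a w.

(* On the span of the words, [trace_to N] is constant modulo [r] for large [N] because
   [d = 1] modulo [r]; its eventual value is a trace modulo [r], with value [1] at [mat1]. *)
Definition trace_to (N : nat) (a : mat) : rat := \sum_(n < d ^ N) a n n.

Lemma matP (a b : mat) : (forall n m, a n m = b n m) -> a = b.
Proof. by move=> ab; apply/funext => n; apply/funext => m. Qed.

Lemma matB (a b : mat) n m : (a - b) n m = a n m - b n m. Proof. by []. Qed.

Lemma matMn (a : mat) k n m : (a *+ k) n m = a n m * k%:R.
Proof. by rewrite natmulfctE natmulfctE mulr_natr. Qed.

Lemma mat_subr0_eq (a b : mat) : a - b = 0 -> a = b.
Proof. by move/eqP; rewrite subr_eq0 => /eqP. Qed.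

Lemma ract_is_zmod_morphism l : zmod_morphism (ract l).
Proof.
move=> a b; apply: matP => n m; rewrite matB /ract.
by case: ifP => // _; case: ifP; rewrite ?subr0 // matB.
Qed.
HB.instance Definition _ l :=
  GRing.isZmodMorphism.Build mat mat (ract l) (ract_is_zmod_morphism l).

Lemma lact_is_zmod_morphism l : zmod_morphism (lact l).
Proof.
move=> a b; apply: matP => n m; rewrite matB /lact.
by case: ifP => // _; case: ifP; rewrite ?subr0 // matB.
Qed.
HB.instance Definition _ l :=
  GRing.isZmodMorphism.Build mat mat (lact l) (lact_is_zmod_morphism l).

Lemma lact_ract l l' a : lact l (ract l' a) = ract l' (lact l a).
Proof.
apply: matP => n m; rewrite /lact /ract.
by case: l.2; case: l'.2 => //; case: ifP => // _; case: ifP.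
Qed.

Lemma divn_mod_eq q n m i : (i < q)%N ->
  (n == m * q + i)%N = (n %% q == i)%N && (n %/ q == m)%N.
Proof.
move=> iq; have q0 : (0 < q)%N by apply: leq_trans iq.
apply/eqP/andP => [->|[/eqP <- /eqP <-]]; last by rewrite -divn_eq.
by rewrite modnMDl modn_small // divnMDl // divn_small // addn0.
Qed.

Lemma digit_eq n m (i : 'I_d) : (n == m * d + i)%N = (n %% d == i)%N && (n %/ d == m)%N.
Proof. exact/divn_mod_eq/ltn_ord. Qed.

Lemma lact_mat1 l : lact l mat1 = ract l mat1.
Proof.
apply: matP => n m; rewrite /lact /ract /mat1; case: l => i [] /=.
  by rewrite digit_eq; case: eqP.
by rewrite eq_sym digit_eq eq_sym; case: eqP => //; rewrite eq_sym.
Qed.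

Lemma wact_is_zmod_morphism w : zmod_morphism (wact^~ w).
Proof. by elim: w => // l w IH a b; rewrite /= raddfB IH. Qed.

Lemma lact_wact l a w : lact l (wact a w) = wact (lact l a) w.
Proof. by elim: w a => //= l' w IH a; rewrite IH lact_ract. Qed.

Lemma lact_wact1 l w : lact l (wact mat1 w) = wact mat1 (l :: w).
Proof. by rewrite lact_wact lact_mat1. Qed.

Lemma wact_cat a w w' : wact a (w ++ w') = wact (wact a w) w'.
Proof. exact: foldl_cat. Qed.

Lemma wact_rcons a w l : wact a (rcons w l) = ract l (wact a w).
Proof. by rewrite -cats1 wact_cat. Qed.

Lemma sum_digits (F : nat -> rat) Q b :
  \sum_(n < Q * b) F n = \sum_(q < Q) \sum_(i < b) F (q * b + i)%N.
Proof.
elim: Q => [|Q IH]; first by rewrite mul0n !big_ord0.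
rewrite [RHS]big_ord_recr /= -IH -!(big_mkord xpredT F).
rewrite (@big_cat_nat _ _ _ (Q * b)%N) //=; last by rewrite leq_mul2r leqnSn orbT.
congr (_ + _); rewrite -{1}[(Q * b)%N]add0n big_addn mulSnr addKn big_mkord.
by apply: eq_bigr => i _; rewrite addnC.
Qed.

Lemma trace_toS N a :
  trace_to N.+1 a = \sum_(q < d ^ N) \sum_(i < d) a (q * d + i)%N (q * d + i)%N.
Proof. by rewrite /trace_to expnSr (sum_digits (fun n => a n n)). Qed.

(** The diagonal of [x_i a] lives on the indices [q d + i], where it equals the [q]-th diagonal
    entry of [a x_i]. The cost is one step in the truncation. *)
Lemma trace_to_lact N i a : trace_to N.+1 (lact (i, true) a) = trace_to N (ract (i, true) a).
Proof.
rewrite trace_toS; apply: eq_bigr => q _; rewrite (bigD1 i) //= big1 ?addr0 => [|j ji].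
  rewrite /lact /ract /= modnMDl modn_small ?eqxx //.
  by rewrite divnMDl // divn_small // addn0.
by rewrite /lact /= modnMDl modn_small // -[_ == _]/(j == i) (negPf ji).
Qed.

Lemma trace_to_ract N i a : trace_to N.+1 (ract (i, false) a) = trace_to N (lact (i, false) a).
Proof.
rewrite trace_toS; apply: eq_bigr => q _; rewrite (bigD1 i) //= big1 ?addr0 => [|j ji].
  rewrite /lact /ract /= modnMDl modn_small ?eqxx //.
  by rewrite divnMDl // divn_small // addn0.
by rewrite /ract /= modnMDl modn_small // -[_ == _]/(j == i) (negPf ji).
Qed.

(* Only a partial equivalence: [eq_evt s s] says that [s] is eventually constant
   modulo [r]. *)
Definition eq_evt (s t : nat -> rat) := exists N0, forall N N', (N0 <= N)%N -> (N0 <= N')%N ->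
  exists z : int, s N - t N' = (r%:Z * z)%:~R.

Lemma eq_evt_sym s t : eq_evt s t -> eq_evt t s.
Proof.
move=> [N0 h]; exists N0 => N N' hN hN'; have [z zE] := h _ _ hN' hN; exists (- z).
by rewrite mulrN rmorphN /= -zE opprB.
Qed.

Lemma eq_evt_trans s t u : eq_evt s t -> eq_evt t u -> eq_evt s u.
Proof.
move=> [N0 h] [N1 h1]; exists (N0 + N1)%N => N N' hN hN'.
have [|z zE] := h N N _ ltac:(lia); first by lia.
have [||z' z'E] := h1 N N'; try lia.
by exists (z + z'); rewrite mulrDr rmorphD /= -zE -z'E addrA subrK.
Qed.

Lemma eq_evtD s t s' t' : eq_evt s t -> eq_evt s' t' -> eq_evt (s + s') (t + t').
Proof.
move=> [N0 h] [N1 h1]; exists (N0 + N1)%N => N N' hN hN'.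
have [||z zE] := h N N'; try lia; have [||z' z'E] := h1 N N'; try lia.
exists (z + z'); rewrite mulrDr rmorphD /= -zE -z'E.
by rewrite -[(s + s') N]/(s N + s' N) -[(t + t') N']/(t N' + t' N') opprD addrACA.
Qed.

Lemma eq_evt0 : eq_evt 0 0.
Proof. by exists 0%N => *; exists 0; rewrite subrr mulr0. Qed.

Lemma eq_evtN s t : eq_evt s t -> eq_evt (- s) (- t).
Proof.
move=> [N0 h]; exists N0 => N N' hN hN'; have [z zE] := h _ _ hN hN'; exists (- z).
by rewrite mulrN rmorphN /= -zE opprB opprK addrC.
Qed.

Lemma eq_evtMz s t z : eq_evt s t -> eq_evt (s *~ z) (t *~ z).
Proof.
move=> st; have stn n : eq_evt (s *+ n) (t *+ n).
  by elim: n => [|n IH]; [exact: eq_evt0|rewrite !mulrS; apply: eq_evtD].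
by case: z => n; [apply: stn|rewrite NegzE !mulrNz; apply/eq_evtN/stn].
Qed.

Lemma eq_evt_shift s t : (forall N, s N.+1 = t N) -> eq_evt s s -> eq_evt s t.
Proof.
by move=> st [N0 h]; exists N0 => N N' hN hN'; rewrite -st; apply: h => //; lia.
Qed.

(** The partial isometry sending the basis vector of index [q d^l' + c'] to that of index
    [q d^l + c]: a product of [l] operators [x_i] followed by [l'] operators [y_i]. *)
Definition monomial (l c l' c' : nat) : mat := fun n m =>
  [&& n %% d ^ l == c, m %% d ^ l' == c' & n %/ d ^ l == m %/ d ^ l']%N%:R.

Lemma modn_mul_modl b q n : ((n %% (q * b)) %% b = n %% b)%N.
Proof. by rewrite modn_dvdm // dvdn_mull. Qed.

Lemma wact_mat1_monomial w : wact mat1 w = 0 \/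
  exists l c l' c', [/\ (c < d ^ l)%N, (c' < d ^ l')%N & wact mat1 w = monomial l c l' c'].
(* Induction on the last letter, using that [y_j x_i] is 1 or 0. A final [y_i] appends a digit to
   [c']; a final [x_i] must match and remove the last digit of [c'], or becomes the leading digit of
   [c] when no [y] is left. *)
Proof.
elim/last_ind: w => [|w [i b] IH].
  right; exists 0%N, 0%N, 0%N, 0%N; split=> //; apply: matP => n m.
  by rewrite /mat1 /monomial /= !expn0 !modn1 !divn1.
rewrite wact_rcons; case: IH => [->|[l [c [l' [c' [cl cl' ->]]]]]]; first by rewrite raddf0; left.
case: b; last first.
  right; exists l, c, l'.+1, (c' * d + i)%N; split=> //.
    by rewrite expnSr; move: (d ^ l')%N cl' => q cl'; have := ltn_ord i; nia.
  apply: matP => n m; rewrite /ract /monomial /= digit_eq.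
  rewrite expnSr modn_mul_modl -modn_divl (mulnC (d ^ l')%N) divnMA.
  by case: eqP => //=; case: eqP.
case: l' cl' => [|k] ck.
  right; exists l.+1, (i * d ^ l + c)%N, 0%N, 0%N; split=> //.
    by rewrite expnS; move: (d ^ l)%N cl => q cl; have := ltn_ord i; nia.
  apply: matP => n m; rewrite /ract /monomial /= !expn0 !modn1 !divn1.
  have -> : c' = 0%N by move: ck; rewrite expn0; case: c'.
  rewrite digit_eq divn_mod_eq // expnS modn_mul_modl -modn_divl (mulnC d) divnMA.
  by rewrite -andbA.
have [ci|ci] := eqVneq (c' %% d)%N i; last first.
  left; apply: matP => n m; rewrite /ract /monomial /= expnSr {1}(divn_eq c' d).
  rewrite divn_mod_eq ?ltn_pmod // modn_mul_modl modnMDl (modn_small (ltn_ord i)).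
  by rewrite [(i : nat) == _]eq_sym (negPf ci) !andbF.
right; exists l, c, k, (c' %/ d)%N; split=> //.
  by rewrite ltn_divLR // -expnSr.
apply: matP => n m; rewrite /ract /monomial /= expnSr {1}(divn_eq c' d).
rewrite divn_mod_eq ?ltn_pmod // modn_mul_modl -modn_divl modnMDl (modn_small (ltn_ord i)).
rewrite ci eqxx /= (mulnC (d ^ k)%N) divnMA divnMDl // (divn_small (ltn_ord i)) addn0.
by [].
Qed.

Lemma expn_d_mod k : exists z, (d ^ k = r * z + 1)%N.
Proof.
elim: k => [|k [z zE]]; first by exists 0%N; rewrite muln0.
by exists (z * d + 1)%N; rewrite expnSr zE; lia.
Qed.

Hypothesis r_gt0 : (0 < r)%N.

(** For [l = l'] the truncated trace is 0, or a power of [d], which is 1 modulo [r]. For [l] and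
    [l'] distinct, equal quotients of [n] must be 0, so only finitely many diagonal entries are
    nonzero and the truncated trace stabilises. *)
Lemma eq_evt_monomial l c l' c' : (c < d ^ l)%N -> (c' < d ^ l')%N ->
  eq_evt (trace_to^~ (monomial l c l' c')) (trace_to^~ (monomial l c l' c')).
Proof.
move=> cl cl'; have [ll'|ll'] := eqVneq l l'.
  subst l'; have [cc'|cc'] := eqVneq c c'; last first.
    suff z N : trace_to N (monomial l c l c') = 0.
      by exists 0%N => *; exists 0; rewrite !z subrr mulr0.
    rewrite /trace_to big1 // => n _; rewrite /monomial.
    by case: eqP => // ->; rewrite (negPf cc').
  subst c'; have tE N : (l <= N)%N -> trace_to N (monomial l c l c) = (d ^ (N - l))%:R.
    move=> lN; rewrite /trace_to.
    have -> : (d ^ N = d ^ (N - l) * d ^ l)%N by rewrite -expnD subnK.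
    rewrite (sum_digits (fun n => monomial l c l c n n)).
    rewrite (eq_bigr (fun=> 1)) ?sumr_const ?card_ord // => q _.
    rewrite (bigD1 (Ordinal cl)) //= big1 => [|j jc].
      by rewrite addr0 /monomial modnMDl modn_small // !eqxx.
    rewrite /monomial modnMDl (modn_small (ltn_ord j)).
    by move: jc; rewrite -val_eqE /= => /negPf ->.
  exists l => N N' lN lN'; rewrite !tE //.
  have [z ->] := expn_d_mod (N - l); have [z' ->] := expn_d_mod (N' - l).
  exists (z%:Z - z'%:Z); rewrite mulrBr rmorphB /= !rmorphM /= !natrD !natrM -!pmulrn.
  by ring.
have d1 : (1 < d)%N by rewrite ltnS.
have dlt (k k' n : nat) : (k < k')%N -> (n %/ d ^ k == n %/ d ^ k')%N -> (n < d ^ k)%N.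
  move=> kk'; rewrite -(subnK kk') addnS -addSn expnD mulnC divnMA => e.
  have d0 : (0 < d ^ k)%N by rewrite expn_gt0.
  case: (posnP (n %/ d ^ k)%N) => [/eqP|q0].
    by rewrite -leqn0 -ltnS ltn_divLR // mul1n.
  have b1 : (1 < d ^ (k' - k.+1).+1)%N by rewrite (leq_ltn_trans _ (ltn_expl _ d1)).
  by have := ltn_Pdiv b1 q0; rewrite -(eqP e) ltnn.
pose N0 := (l + l')%N.
have tE N : (N0 <= N)%N -> trace_to N (monomial l c l' c') = trace_to N0 (monomial l c l' c').
  move=> hN; rewrite /trace_to -!(big_mkord xpredT (fun n => monomial l c l' c' n n)).
  rewrite (@big_cat_nat _ _ _ (d ^ N0)%N) //=; last by rewrite leq_exp2l.
  rewrite [X in _ + X]big1_seq ?addr0 // => n /andP[_]; rewrite mem_index_iota => /andP[nN _].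
  rewrite /monomial; suff /negPf -> : (n %/ d ^ l != n %/ d ^ l')%N by rewrite !andbF.
  apply/negP => e; suff : (n < d ^ N0)%N by rewrite ltnNge nN.
  case: (ltngtP l l') ll' => // h _.
    by apply: leq_trans (dlt _ _ _ h e) _; rewrite leq_exp2l // leq_addr.
  by rewrite eq_sym in e; apply: leq_trans (dlt _ _ _ h e) _; rewrite leq_exp2l // leq_addl.
by exists N0 => N N' hN hN'; exists 0; rewrite !tE // subrr mulr0.
Qed.

Lemma eq_evt_wact w : eq_evt (trace_to^~ (wact mat1 w)) (trace_to^~ (wact mat1 w)).
Proof.
have [->|[l [c [l' [c' [cl cl' ->]]]]]] := wact_mat1_monomial w; last exact: eq_evt_monomial.
suff z N : trace_to N 0 = 0 by exists 0%N => *; exists 0; rewrite !z subrr mulr0.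
by rewrite /trace_to big1.
Qed.

(** A letter moves from front to back at the cost of one truncation step, which is harmless because
    the traces of words are eventually constant modulo [r]. *)
Lemma eq_evt_rotate1 l w :
  eq_evt (trace_to^~ (wact mat1 (l :: w))) (trace_to^~ (wact mat1 (rcons w l))).
Proof.
have e1 := eq_evt_wact (l :: w); have e2 := eq_evt_wact (rcons w l).
move: e1 e2; rewrite -lact_wact1 wact_rcons; case: l => i [] e1 e2.
  by apply: eq_evt_shift e1 => N; apply: trace_to_lact.
by apply/eq_evt_sym/(eq_evt_shift _ e2) => N; apply: trace_to_ract.
Qed.

Lemma eq_evt_cat w w' :
  eq_evt (trace_to^~ (wact mat1 (w ++ w'))) (trace_to^~ (wact mat1 (w' ++ w))).
Proof.
elim: w w' => [|l w IH] w'; first by rewrite cats0; apply: eq_evt_wact.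
apply: eq_evt_trans (eq_evt_rotate1 l (w ++ w')) _.
by rewrite rcons_cat -cat_rcons; apply: IH.
Qed.

(** * The group of germs *)

Definition trace_seq (a : mat) : nat -> rat := trace_to^~ a.

Lemma trace_seq_is_zmod_morphism : zmod_morphism trace_seq.
Proof.
move=> a b; apply/funext => N; rewrite -[RHS]/(trace_to N a - trace_to N b).
by rewrite /trace_seq /trace_to -sumrB.
Qed.
HB.instance Definition _ :=
  GRing.isZmodMorphism.Build mat (nat -> rat) trace_seq trace_seq_is_zmod_morphism.

Definition wact_by w (a : mat) := wact a w.
HB.instance Definition _ w :=
  GRing.isZmodMorphism.Build mat mat (wact_by w) (wact_is_zmod_morphism w).

(** A name, not unique, for an element of the Leavitt ring as an integer combination of words;
    [comb a c] is the product of [a] with the element named by [c]. *)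
Definition form : Type := seq (int * seq letter).

Definition comb (a : mat) (c : form) : mat := \sum_(t <- c) wact a t.2 *~ t.1.

Definition leavitt (u : mat) := exists c, u = comb mat1 c.

Lemma wactMz a w z : wact (a *~ z) w = wact a w *~ z.
Proof. exact: (raddfMz (wact_by w)). Qed.

Lemma wact_sum I (s : seq I) (F : I -> mat) w :
  wact (\sum_(i <- s) F i) w = \sum_(i <- s) wact (F i) w.
Proof. exact: (raddf_sum (wact_by w)). Qed.

Lemma comb_is_zmod_morphism c : zmod_morphism (comb^~ c).
Proof.
move=> a b; rewrite /comb -sumrB; apply: eq_bigr => t _.
by rewrite wact_is_zmod_morphism mulrzBl.
Qed.
Definition comb_by c (a : mat) := comb a c.
HB.instance Definition _ c :=
  GRing.isZmodMorphism.Build mat mat (comb_by c) (comb_is_zmod_morphism c).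

Lemma combMn a c n : comb (a *+ n) c = comb a c *+ n.
Proof. exact: (raddfMn (comb_by c)). Qed.

Lemma comb1 a : comb a [:: (1, [::])] = a.
Proof. by rewrite /comb big_seq1 mulr1z. Qed.

Lemma comb_cat a c c' : comb a (c ++ c') = comb a c + comb a c'.
Proof. exact: big_cat. Qed.

Lemma leavitt_sub : is_subgroup leavitt.
Proof.
split=> [|_ _ [c ->] [c' ->]]; first by exists [::]; rewrite /comb big_nil.
exists (c ++ [seq (- t.1, t.2) | t <- c']); rewrite comb_cat; congr (_ + _).
by rewrite /comb big_map -sumrN; apply: eq_bigr => t _; rewrite mulrNz.
Qed.

(** The trace identity [tr (u w) = tr (w u)] modulo [r], reduced to words by bilinearity. *)
Lemma eq_evt_comb c c' :
  eq_evt (trace_seq (comb (comb mat1 c) c')) (trace_seq (comb (comb mat1 c') c)).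
Proof.
have combE a b : comb (comb mat1 a) b =
    \sum_(t <- b) \sum_(u <- a) wact mat1 (u.2 ++ t.2) *~ (u.1 * t.1).
  apply: eq_bigr => t _; rewrite wact_sum mulrz_suml; apply: eq_bigr => u _.
  by rewrite wactMz -wact_cat mulrzA.
rewrite !combE [in X in eq_evt _ X]exchange_big /=.
do 2!(rewrite !raddf_sum /=; apply: (big_ind2 eq_evt);
  [exact: eq_evt0|by move=> *; apply: eq_evtD|move=> ? _]).
by rewrite !raddfMz /= mulrC; apply/eq_evtMz/eq_evt_cat.
Qed.

(** * The ambient rational group, its lines and the group they span *)

Local Notation hull := (bool -> mat).

Definition smul (x : rat) (h : hull) : hull := fun s n m => x * h s n m.

Lemma hullP (a b : hull) : (forall s n m, a s n m = b s n m) -> a = b.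
Proof. by move=> ab; apply/funext => s; apply/matP => n m. Qed.

Lemma hullD (a b : hull) s n m : (a + b) s n m = a s n m + b s n m. Proof. by []. Qed.
Lemma hullDs (a b : hull) s : (a + b) s = a s + b s. Proof. by []. Qed.
Lemma hullB (a b : hull) s n m : (a - b) s n m = a s n m - b s n m. Proof. by []. Qed.

Lemma smul_is_zmod_morphism x : zmod_morphism (smul x).
Proof. by move=> a b; apply: hullP => s n m; rewrite hullB /smul mulrBr. Qed.
HB.instance Definition _ x :=
  GRing.isZmodMorphism.Build hull hull (smul x) (smul_is_zmod_morphism x).

Lemma smulA x y h : smul x (smul y h) = smul (x * y) h.
Proof. by apply: hullP => s n m; rewrite /smul mulrA. Qed.

Lemma smul1 h : smul 1 h = h.
Proof. by apply: hullP => s n m; rewrite /smul mul1r. Qed.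

Lemma smul_nat n h : smul n%:R h = h *+ n.
Proof.
elim: n => [|n IH].
  by apply: hullP => s n m; rewrite /smul mul0r.
rewrite [RHS]mulrSr -IH; apply: hullP => s k m.
by rewrite hullD /smul -natr1 mulrDl mul1r.
Qed.

Definition op : Type := option (option (option letter)).

(* [None] stands for the vertical line, the other cases for the graphs of [0], of the
   identity and of the right multiplications by the letters. *)
Definition emb (o : op) (u : mat) : hull := fun s => match o, s with
  | None, false => 0 | None, true => u
  | Some _, false => u
  | Some None, true => 0
  | Some (Some None), true => u
  | Some (Some (Some l)), true => ract l u
  end.

(** The defining equation of the line of [o]: its kernel is the image of [emb o]. *)
Definition detect (o : op) (h : hull) : mat := match o with
  | None => h false
  | Some None => h true
  | Some (Some None) => h true - h false
  | Some (Some (Some l)) => h true - ract l (h false)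
  end.

Lemma emb_is_zmod_morphism o : zmod_morphism (emb o).
Proof.
move=> u w; apply/funext => s; rewrite -[RHS]/(emb o u s - emb o w s).
by case: o => [[[l|]|]|]; case: s; rewrite /= ?subrr ?raddfB.
Qed.
HB.instance Definition _ o :=
  GRing.isZmodMorphism.Build mat hull (emb o) (emb_is_zmod_morphism o).

Lemma detect_is_zmod_morphism o : zmod_morphism (detect o).
Proof.
move=> u w; have sB s : (u - w) s = u s - w s by [].
have BB (a b c e : mat) : a - b - (c - e) = a - c - (b - e).
  by rewrite !opprD addrACA.
by case: o => [[[l|]|]|] //=; rewrite !sB ?ract_is_zmod_morphism; apply: BB.
Qed.
HB.instance Definition _ o :=
  GRing.isZmodMorphism.Build hull mat (detect o) (detect_is_zmod_morphism o).

Lemma detect_emb o u : detect o (emb o u) = 0.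
Proof. by case: o => [[[l|]|]|] //=; rewrite subrr. Qed.

Definition integral (a : mat) := forall n m, a n m \is a Num.int.

Lemma integral_ract l a : integral a -> integral (ract l a).
Proof. by move=> ai n m; rewrite /ract; case: ifP => // _; case: ifP. Qed.

Lemma integral_sub : is_subgroup integral.
Proof. by split=> // a b ai bi n m; rewrite matB rpredB. Qed.

Lemma integral_leavitt u : leavitt u -> integral u.
Proof.
move=> [c ->]; apply: (big_ind integral) => // [a b|t _].
  exact: (subgroupD integral_sub).
have wi : integral (wact mat1 t.2).
  elim/last_ind: t.2 => [|w l IH]; last by rewrite wact_rcons; apply: integral_ract.
  by move=> n m; rewrite /mat1 rpred_nat.
exact: (subgroupMz integral_sub).
Qed.

Lemma integral_emb o u s : integral u -> integral (emb o u s).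
Proof. by case: o => [[[l|]|]|]; case: s => //= ui; apply: integral_ract. Qed.

Lemma integral_detect o (h : hull) : (forall s, integral (h s)) -> integral (detect o h).
Proof.
by move=> hi; case: o => [[[l|]|]|] //=; apply: integral_sub.2 => //; apply: integral_ract.
Qed.

Variable P : op -> nat.
Hypothesis P_gt1 : forall o, (1 < P o)%N.
Hypothesis P_coprime : forall o o', o != o' -> coprime (P o) (P o').
Hypothesis P_r : forall o, coprime (P o) r.

Lemma P_neq0 o : (P o)%:R != 0 :> rat.
Proof. by rewrite pnatr_eq0 -lt0n ltnW. Qed.

(* The spanned group is [sum_o P_o^(-oo) {emb o u | u in leavitt}]. *)
Definition gen (t : op * nat * form) : hull :=
  smul ((P t.1.1)%:R ^- t.1.2) (emb t.1.1 (comb mat1 t.2)).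

Definition hspan (h : hull) := exists s, h = \sum_(t <- s) gen t.

Lemma gen_clear o k c : gen (o, k, c) *+ P o ^ k = emb o (comb mat1 c).
Proof.
by rewrite -smul_nat smulA natrX mulfV ?smul1 // expf_neq0 ?P_neq0.
Qed.

Lemma gen_shift o k N c : gen (o, k, c) = gen (o, (k + N)%N, c) *+ P o ^ N.
Proof.
rewrite -smul_nat smulA natrX /gen /= exprD; congr smul.
by rewrite invfM mulrCA mulfV ?mulr1 // expf_neq0 ?P_neq0.
Qed.

Lemma hspan_sub : is_subgroup hspan.
Proof.
split=> [|_ _ [s ->] [s' ->]]; first by exists [::]; rewrite big_nil.
exists (s ++ [seq (t.1, [seq (- u.1, u.2) | u <- t.2]) | t <- s']).
rewrite big_cat big_map /= -sumrN; congr (_ + _); apply: eq_bigr => t _.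
rewrite /gen /= -raddfN -raddfN; congr (smul _ (emb _ _)).
by rewrite /comb big_map -sumrN; apply: eq_bigr => u _; rewrite mulrNz.
Qed.

Lemma countable_hspan : countable_set hspan.
Proof.
pose f (s : seq (op * nat * form)) := \sum_(t <- s) gen t.
apply: (@countable_image _ _ (fun _ : seq ((option (option (option ('I_d * bool)))) * nat
  * seq (int * seq ('I_d * bool))) => True) _ f).
  exact: countType_countable.
by move=> _ [s ->]; exists s.
Qed.

Lemma hspan_gen t : hspan (gen t).
Proof. by exists [:: t]; rewrite big_seq1. Qed.

Lemma hspan_emb o u : leavitt u -> hspan (emb o u).
Proof.
move=> [c ->]; have := hspan_gen (o, 0%N, c).
by rewrite -[gen _]mulr1n -(gen_clear o 0 c).
Qed.

Lemma hspan_ind (Q : hull -> Prop) : Q 0 -> (forall a b, Q a -> Q b -> Q (a + b)) ->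
  (forall t, Q (gen t)) -> forall h, hspan h -> Q h.
Proof. by move=> Q0 QD Qg _ [s ->]; apply: (big_ind Q). Qed.

(** The chain of subgroups H_k: with denominators bounded by a fixed number, clearing them embeds
    each level in a power of Z. *)
Definition level (k : nat) (h : hull) := forall s, integral (h s *+ (\prod_o P o) ^ k).

Lemma levelW k l h : (k <= l)%N -> level k h -> level l h.
Proof.
move=> kl hk s; rewrite -(subnK kl) expnD mulnC mulrnA; exact: (subgroupMn integral_sub).
Qed.

Lemma level_sub k : is_subgroup (level k).
Proof.
split=> [s|a b ak bk s]; first by rewrite [_ s]/(0 : mat) mul0rn.
by rewrite [_ s]/(a s - b s) mulrnBl; apply: integral_sub.2.
Qed.

Lemma hullMn (h : hull) n s : (h *+ n) s = h s *+ n.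
Proof. by rewrite natmulfctE. Qed.

Lemma level_ex h : hspan h -> exists k, level k h.
Proof.
move: h; apply: hspan_ind => [|a b [k ak] [l bl]|[[o k] c]].
- by exists 0%N; apply: (level_sub 0).1.
- by exists (k + l)%N; apply: (subgroupD (level_sub _)); [apply: levelW ak|apply: levelW bl]; lia.
exists k => s; rewrite (bigD1 o) //= expnMn mulrnA -hullMn gen_clear.
exact/(subgroupMn integral_sub)/integral_emb/integral_leavitt/(ex_intro _ c).
Qed.

Lemma detect_clear o h : hspan h ->
  exists2 s, coprime s (P o) & integral (detect o h *+ s).
Proof.
move: h; apply: hspan_ind => [|a b [k ak ia] [l bl ib]|[[o' k] c]].
- by exists 1%N; rewrite ?coprime1n // raddf0.
- exists (k * l)%N; first by rewrite coprimeMl ak.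
  rewrite raddfD mulrnDl; apply: (subgroupD integral_sub).
    by rewrite mulrnA; apply: (subgroupMn integral_sub).
  by rewrite mulnC mulrnA; apply: (subgroupMn integral_sub).
have [<-|oo'] := eqVneq o' o.
  exists 1%N; rewrite ?coprime1n // mulr1n.
  suff -> : detect o' (gen (o', k, c)) = 0 by [].
  apply/matP => n m.
  have /eqP : detect o' (gen (o', k, c) *+ P o' ^ k) n m = 0 by rewrite gen_clear detect_emb.
  rewrite raddfMn natmulfctE natmulfctE mulrn_eq0 expn_eq0 => /orP[/andP[/eqP p0]|/eqP //].
  by have := P_gt1 o'; rewrite p0.
exists (P o' ^ k)%N; first by rewrite coprimeXl // P_coprime.
rewrite -raddfMn gen_clear; apply: integral_detect => s.
exact/integral_emb/integral_leavitt/(ex_intro _ c).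
Qed.

(** All denominators are products of the [P o], hence prime to [r], and can be cleared without
    losing information modulo [r]. *)
Lemma first_clear h : hspan h ->
  exists s, [/\ (0 < s)%N, coprime s r & leavitt (h false *+ s)].
Proof.
have LD := subgroupD leavitt_sub; have LM := subgroupMn leavitt_sub.
move: h; apply: hspan_ind => [|a b [k [k0 ak ia]] [l [l0 bl ib]]|[[o k] c]].
- by exists 1%N; split; rewrite ?coprime1n //; exact: leavitt_sub.1.
- exists (k * l)%N; split; [by rewrite muln_gt0 k0|by rewrite coprimeMl ak|].
  rewrite [_ false]/(a false + b false) mulrnDl; apply: LD; first by rewrite mulrnA; exact: LM.
  by rewrite mulnC mulrnA; apply: LM.
exists (P o ^ k)%N; split; [by rewrite expn_gt0 ltnW|by rewrite coprimeXl|].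
rewrite -hullMn gen_clear; by case: o => [[[l|]|]|]; try exact: leavitt_sub.1; exists c.
Qed.

(* The [P o]-divisible part of the span is the line of [o]: [detect o] kills that line
   and takes denominators prime to [P o] on the others. *)
Lemma detect_pdivisible o h : (forall N, exists2 h', hspan h' & h = h' *+ P o ^ N) ->
  detect o h = 0.
Proof.
move=> hdiv; apply/matP => n m; apply/eqP/negPn/negP; rewrite -[(0 : mat) n m]/0.
set q := detect o h n m => q0.
have q1 N : exists z : int, exists2 s, coprime s (P o) & q * s%:R = (P o)%:R ^+ N * z%:~R.
  have [h' /(detect_clear o)[s sP si] hE] := hdiv N.
  have /intrP[z zE] := si n m; exists z, s => //.
  by rewrite /q hE raddfMn matMn natrX -zE matMn -mulrA mulrCA.
pose x := numq q; have x0 : x != 0 by rewrite numq_eq0.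
have pdvd N : (P o ^ N %| `|x|)%N.
  have [z [s sP e]] := q1 N.
  rewrite -(@Gauss_dvdr _ s); last by rewrite coprimeXl // coprime_sym.
  apply/dvdnP; exists (`|z| * `|denq q|)%N.
  have : (s%:Z * x)%:~R = ((P o ^ N)%:Z * (z * denq q))%:~R :> rat.
    rewrite !rmorphM /= -!pmulrn natrX /x numqE.
    transitivity (q * s%:R * (denq q)%:~R); first by rewrite mulrCA mulrA.
    by rewrite e mulrA.
  by move=> /intr_inj /(congr1 absz); rewrite !abszM !absz_nat mulnC [RHS]mulnC => ->; rewrite mulnC.
have : (P o ^ `|x| <= `|x|)%N by apply: dvdn_leq => //; rewrite absz_gt0.
by rewrite leqNgt ltn_expl.
Qed.

(** * Endomorphisms of the spanned group and the invariant modulo [r] *)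

Section SpanGroup.
Variables (H : zmodType) (v : {additive H -> hull}).
Hypothesis v_inj : injective v.
Hypothesis vP : forall x, hspan x <-> exists g, v g = x.

Lemma hspan_v g : hspan (v g). Proof. by apply/vP; exists g. Qed.

Definition form1 : form := [:: (1, [::])].

Lemma vMn g n s : v (g *+ n) s = v g s *+ n.
Proof. by rewrite raddfMn hullMn. Qed.

Lemma lact_emb l o u s : lact l (emb o u s) = emb o (lact l u) s.
Proof. by case: o => [[[l'|]|]|]; case: s => //=; rewrite ?lact_ract ?raddf0. Qed.

(** Every line other than the vertical one is the graph of 0, the identity or a right
    multiplication; left multiplications commute with these and so preserve all the lines. *)
Lemma lact_extends l :
  exists th : {additive H -> H}, forall g s, v (th g) s = lact l (v g s).
Proof.
have /choice[t tP] : forall g, exists g', v g' = fun s => lact l (v g s).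
  move=> g; apply/vP; move: (v g) (hspan_v g); apply: hspan_ind => [|a b ah bh|[[o k] c]].
  - by exists [::]; rewrite big_nil; apply/funext => s; rewrite [LHS]raddf0.
  - have [h0 hB] := hspan_sub.
    have -> : (fun s => lact l ((a + b) s)) = (fun s => lact l (a s)) -
        (0 - fun s => lact l (b s)).
      rewrite sub0r opprK; apply/funext => s; exact: raddfD.
    by apply: (hB) => //; apply: (hB).
  exists [:: (o, k, [seq (t.1, l :: t.2) | t <- c])]; rewrite big_seq1.
  have -> : gen (o, k, [seq (t.1, l :: t.2) | t <- c]) =
      smul ((P o)%:R ^- k) (emb o (lact l (comb mat1 c))).
    rewrite /gen /=; congr (smul _ (emb _ _)).
    rewrite /comb big_map raddf_sum; apply: eq_bigr => t _.
    by rewrite -lact_wact1 raddfMz.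
  apply: hullP => s n m; rewrite [RHS]/smul -lact_emb /gen /lact /smul.
  by case: ifP => // _; case: ifP; rewrite ?mulr0.
have [th thE] : exists th : {additive H -> H}, th =1 t.
  apply: additive_of => g g'; apply: v_inj; rewrite raddfD !tP.
  by apply/funext => s; rewrite raddfD -[RHS]raddfD.
by exists th => g s; rewrite thE tP.
Qed.

Lemma emb_lift (o : op) c : exists g, v g = emb o (comb mat1 c).
Proof. by apply/vP/hspan_emb; exists c. Qed.

(** An element of the line of [o] is divisible by all powers of [P o] in [H], and so is its
    image. *)
Lemma detect_map (th : {additive H -> H}) o c g :
  v g = emb o (comb mat1 c) -> detect o (v (th g)) = 0.
Proof.
move=> gE; apply: detect_pdivisible => N.
have /vP[g' g'E] := hspan_gen (o, N, c).
exists (v (th g')); first exact: hspan_v.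
rewrite -raddfMn -raddfMn; congr (v (th _)); apply: v_inj.
by rewrite raddfMn g'E gen_clear.
Qed.

(* An additive map respects the vertical line, the horizontal line and the diagonal,
   hence acts on both coordinates by one map [f]; the remaining graphs make [f]
   commute with the right multiplications, so [f] is the left multiplication by [f 1]. *)
Lemma additive_map_comb (th : {additive H -> H}) c g g1 :
  v g = emb (Some None) (comb mat1 c) -> v g1 = emb (Some None) mat1 ->
  v (th g) = emb (Some None) (comb (v (th g1) false) c).
Proof.
have /choice[E EP] := fun c => emb_lift (Some None) c.
have /choice[E' E'P] := fun c => emb_lift None c.
pose f c := v (th (E c)) false.
have fE c' : v (th (E c')) = emb (Some None) (f c').
  by have := detect_map th (EP c') => /= h; apply/funext => -[].
have f'E c' : v (th (E' c')) true = f c'.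
  have h0 : v (th (E' c')) false = 0 := detect_map th (E'P c').
  have h : v (E c' + E' c') = emb (Some (Some None)) (comb mat1 c').
    by rewrite raddfD EP E'P; apply/funext => -[]; rewrite hullDs /= ?addr0 ?add0r.
  have /mat_subr0_eq := detect_map th h; by rewrite (raddfD th) (raddfD v) fE !hullDs h0 add0r addr0.
have f_ract l c' c'' : comb mat1 c'' = ract l (comb mat1 c') -> f c'' = ract l (f c').
  move=> cc; have h : v (E c' + E' c'') = emb (Some (Some (Some l))) (comb mat1 c').
    by rewrite raddfD EP E'P cc; apply/funext => -[]; rewrite hullDs /= ?addr0 ?add0r.
  have h0 : v (th (E' c'')) false = 0 := detect_map th (E'P c'').
  have /mat_subr0_eq := detect_map th h; by rewrite (raddfD th) (raddfD v) fE !hullDs h0 f'E add0r addr0.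
have fw w : f [:: (1, w)] = wact (f form1) w.
  elim/last_ind: w => // w l IH; rewrite wact_rcons -IH; apply: f_ract.
  by rewrite /comb !big_seq1 /= !mulr1z wact_rcons.
move=> gE g1E; have -> : g1 = E form1 by apply: v_inj; rewrite g1E EP comb1.
have -> : g = \sum_(t <- c) E [:: (1, t.2)] *~ t.1.
  apply: v_inj; rewrite gE raddf_sum /comb raddf_sum; apply: eq_bigr => t _.
  by rewrite !raddfMz EP /comb big_seq1 mulr1z.
rewrite -/(f form1) /comb !raddf_sum; apply: eq_bigr => t _.
by rewrite !raddfMz fE fw.
Qed.

Lemma common_clear (T : finType) (u : T -> mat) :
  (forall t, exists s, [/\ (0 < s)%N, coprime s r & leavitt (u t *+ s)]) ->
  exists s, [/\ (0 < s)%N, coprime s r & forall t, leavitt (u t *+ s)].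
Proof.
move=> /choice[s sP]; exists (\prod_t s t)%N; split.
- by rewrite prodn_gt0 // => t; have [] := sP t.
- by apply: (big_ind (fun k => coprime k r)) => [|k l kr lr|t _]; rewrite ?coprime1n ?coprimeMl ?kr //; have [] := sP t.
move=> t; have [_ _ [c cE]] := sP t; rewrite (bigD1 t) //= mulrnA cE.
by apply: (subgroupMn leavitt_sub); exists c.
Qed.

Definition row_at m (b : 'I_m) (h : H) : 'rV[H]_m := \row_j if j == b then h else 0.

Lemma row_atD m (b : 'I_m) : {morph row_at b : x y / x + y}.
Proof. by move=> x y; apply/rowP => j; rewrite !mxE; case: ifP; rewrite ?addr0. Qed.

Lemma row_map_comb m n (phi : {additive 'rV[H]_m -> 'rV[H]_n}) g1 b j c g :
  v g1 = emb (Some None) mat1 -> v g = emb (Some None) (comb mat1 c) ->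
  v (phi (row_at b g) 0 j) =
    emb (Some None) (comb (v (phi (row_at b g1) 0 j) false) c).
Proof.
move=> g1E gE; have [th thE] : exists th : {additive H -> H}, th =1 fun h => phi (row_at b h) 0 j.
  by apply: additive_of => x y; rewrite row_atD raddfD mxE.
by rewrite -!thE; apply: additive_map_comb.
Qed.

(** The diagonal entry at [b] of the matrix identity expressing that [psi] inverts [phi], with
    denominators cleared by [S] in each factor. *)
Lemma matrix_inverse m n (phi : {additive 'rV[H]_m -> 'rV[H]_n})
    (psi : {additive 'rV[H]_n -> 'rV[H]_m}) g1 S
    (alpha : 'I_m -> 'I_n -> form) (beta : 'I_n -> 'I_m -> form) (b : 'I_m) :
  cancel phi psi -> v g1 = emb (Some None) mat1 ->
  (forall b j, v (phi (row_at b g1) 0 j) false *+ S = comb mat1 (alpha b j)) ->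
  (forall j b, v (psi (row_at j g1) 0 b) false *+ S = comb mat1 (beta j b)) ->
  mat1 *+ (S * S) = \sum_j comb (comb mat1 (beta j b)) (alpha b j).
Proof.
move=> phiK g1E aE bE.
have /choice[E EP] := fun c => emb_lift (Some None) c.
have h : phi (row_at b g1) *+ S = \sum_j row_at j (E (alpha b j)).
  apply/rowP => j; rewrite mulmxnE summxE (bigD1 j) //= mxE eqxx big1 ?addr0 => [|i ij].
    apply: v_inj; rewrite EP -aE raddfMn (@row_map_comb _ _ phi g1 b j form1 g1) //.
      by rewrite raddfMn comb1.
    by rewrite comb1.
  by rewrite mxE eq_sym (negPf ij).
have := congr1 psi h; rewrite raddfMn phiK raddf_sum => /(congr1 (fun x : 'rV_m => x 0 b)).
rewrite mulmxnE summxE mxE eqxx => /(congr1 (fun x => v x false)).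
rewrite vMn g1E /= => /(congr1 (fun x => x *+ S)); rewrite -mulrnA => ->.
rewrite [v _]raddf_sum fct_sumE -sumrMnl; apply: eq_bigr => j _.
by rewrite (row_map_comb psi j b g1E (EP _)) /= -combMn bE.
Qed.

(** Sum the traces of the diagonal entries for both composites: the terms are [be al] on one side
    and [al be] on the other, so [S^2 m] and [S^2 n] agree modulo [r], and [S] is prime to [r]. *)
Lemma hspan_iso_mod m n : group_iso ('rV[H]_m) ('rV[H]_n) -> m = n %[mod r].
Proof.
move=> /group_iso_additive[phi [psi [phiK psiK]]].
have [g1 g1E] := emb_lift (Some None) form1; rewrite comb1 in g1E.
have cl g : exists s, [/\ (0 < s)%N, coprime s r & leavitt (v g false *+ s)].
  exact/first_clear/hspan_v.
have [S [S0 Sr SP]] := @common_clear (('I_m * 'I_n) + ('I_n * 'I_m))%type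
  (fun t => match t with inl bj => v (phi (row_at bj.1 g1) 0 bj.2) false
                       | inr jb => v (psi (row_at jb.1 g1) 0 jb.2) false end)
  (fun t => match t with inl _ => cl _ | inr _ => cl _ end).
have /choice[a aE] := fun bj => SP (inl bj); have /choice[b bE] := fun jb => SP (inr jb).
pose al i j := a (i, j); pose be j i := b (j, i).
have e1 i := @matrix_inverse m n phi psi g1 S al be i phiK g1E
  (fun i j => aE (i, j)) (fun j i => bE (j, i)).
have e2 j := @matrix_inverse n m psi phi g1 S be al j psiK g1E
  (fun j i => bE (j, i)) (fun i j => aE (i, j)).
have : eq_evt (trace_seq (mat1 *+ (S * S * m))) (trace_seq (mat1 *+ (S * S * n))).
  have -> : mat1 *+ (S * S * m) = \sum_(i < m) \sum_(j < n) comb (comb mat1 (be j i)) (al i j).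
    by under eq_bigr => i _ do rewrite -e1; rewrite sumr_const card_ord -mulrnA.
  have -> : mat1 *+ (S * S * n) = \sum_(i < m) \sum_(j < n) comb (comb mat1 (al i j)) (be j i).
    by rewrite exchange_big /=; under eq_bigr => j _ do rewrite -e2; rewrite sumr_const card_ord -mulrnA.
  do 2!(rewrite !raddf_sum; apply: (big_ind2 eq_evt);
    [exact: eq_evt0|by move=> *; apply: eq_evtD|move=> ? _]).
  exact: eq_evt_comb.
have tE k N : trace_seq (mat1 *+ k) N = (k * d ^ N)%:R.
  rewrite raddfMn natmulfctE /= /trace_seq /trace_to (eq_bigr (fun=> 1)).
    by rewrite sumr_const card_ord -mulrnA mulnC.
  by move=> i _; rewrite /mat1 eqxx.
move=> [N /(_ N N (leqnn _) (leqnn _))[z]]; rewrite !tE => e.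
(* The truncated traces carry a common factor [d ^ N], which is 1 modulo [r]. *)
have {e} : (r %| (S * S)%N%:Z * (m%:Z - n%:Z))%Z.
  have [y yE] := expn_d_mod N.
  have ze : (S * S * m * d ^ N)%:Z - (S * S * n * d ^ N)%:Z = r%:Z * z.
    by apply: (@intr_inj rat); rewrite rmorphB /= -!pmulrn.
  apply/dvdzP; exists (z - (S * S)%:Z * y%:Z * (m%:Z - n%:Z)).
  by move: ze; rewrite yE !PoszM !PoszD !PoszM; lia.
rewrite Gauss_dvdzr; last by rewrite coprimezE /= coprime_sym coprimeMl Sr.
by rewrite -eqz_mod_dvd !modz_nat => /eqP[].
Qed.

End SpanGroup.

Lemma leavitt_module_exists : exists M : zmodType, [/\ aleph1_separable M, card_aleph1 M,
  group_iso ('rV[M]_1) ('rV[M]_d) & forall m n,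
  group_iso ('rV[M]_m) ('rV[M]_n) -> m = n %[mod r]].
Proof.
have [H [v [v_inj vP]]] := subgroup_zmodType hspan_sub.
have vspan g : hspan (v g) by apply/vP; exists g.
pose e k g (i : bool * nat * nat) := numq ((v g i.1.1 *+ (\prod_o P o) ^ k) i.1.2 i.2).
have eP k g i : level k (v g) -> (e k g i)%:~R = (v g i.1.1 *+ (\prod_o P o) ^ k) i.1.2 i.2.
  by move=> /(_ i.1.1 i.1.2 i.2)/intrP[z zE]; rewrite /e zE numq_int.
have /choice[X XP] := fun i : 'I_d => lact_extends v_inj vP (i, true).
have /choice[Y YP] := fun i : 'I_d => lact_extends v_inj vP (i, false).
have lact_level l k (g g' : H) : (forall s, v g' s = lact l (v g s)) ->
    level k (v g) -> level k (v g').
  move=> gE lg s; have gs := gE s; rewrite gs -[_ *+ _](raddfMn (lact l)).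
  move: (v g s *+ _) (lg s) => a ai n m.
  by rewrite /= /lact; case: ifP => _; [case: ifP => _; [exact: ai|exact: rpred0]|exact: ai].
have [h0 h0E] := emb_lift vP (Some None) form1; rewrite comb1 in h0E.
have v_ext g g' : (forall s n m, v g s n m = v g' s n m) -> g = g'.
  by move=> h; apply/v_inj/hullP.
have vsum I (s : seq I) F b : v (\sum_(i <- s) F i) b = \sum_(i <- s) v (F i) b.
  by rewrite raddf_sum fct_sumE.
have vs b : {morph v^~ b : x y / x + y} by move=> x y; rewrite raddfD.
case: (@ladder_module_exists H (fun k g => level k (v g)) _ e d X Y h0).
- have [c ci] := countable_hspan; exists (c \o v) => x y _ _ /ci h.
  exact/v_inj/h.
- move=> k; split=> [|x y xk yk]; first by rewrite raddf0; apply: (level_sub k).1.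
  by rewrite raddfB; apply: (level_sub k).2.
- by move=> k l h; apply: levelW.
- by move=> h; apply: level_ex.
- move=> k x y xk yk; apply/funext => i; apply: (@intr_inj rat).
  rewrite -[(e k x + e k y) i]/(e k x i + e k y i) rmorphD /= !eP //.
    by rewrite vs mulrnDl.
  by rewrite raddfD; apply: (subgroupD (level_sub k)).
- move=> k x xk ex; apply: v_ext => s n m; rewrite raddf0.
  have := eP k x (s, n, m) xk; rewrite ex /= natmulfctE natmulfctE => /esym/eqP.
  rewrite mulrn_eq0 expn_eq0 => /orP[/andP[/eqP p0]|/eqP //].
  have : (0 < \prod_o P o)%N by apply: prodn_gt0 => o; rewrite ltnW.
  by rewrite p0.
- apply/eqP => h00; have := h0E; rewrite h00 raddf0.
  by move=> /(congr1 (fun h : hull => h false 0%N 0%N)) /eqP; rewrite /= eq_sym oner_eq0.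
- move=> h; have [s sE] := vspan h.
  have /choice[g gE] : forall t, exists g, v g = gen t by move=> t; apply/vP/hspan_gen.
  exists (map g s).
    by rewrite big_map; apply: v_inj; rewrite raddf_sum sE; apply: eq_bigr => t _; rewrite gE.
  (* A generator is divisible by [P o ^ N] because the exponent of its denominator can be raised by
     [N]. *)
  move=> _ /mapP[[[o k] c] _ ->]; exists (P o) => // N.
  exists (g (o, (k + N)%N, c)); apply: v_inj.
  by rewrite raddfMn !gE; apply: gen_shift.
- by move=> i k h; apply: lact_level (XP i h).
- by move=> i k h; apply: lact_level (YP i h).
- move=> i j h; apply: v_ext => s n m; rewrite YP XP /lact /= modnMDl modn_small //.
  rewrite -[_ == _]/(i == j); case: ifP => _; last by rewrite raddf0.
  by rewrite divnMDl // divn_small // addn0.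
- move=> h; apply: v_ext => s n m; rewrite vsum !fct_sumE.
  (* In row [n] only the index [n] modulo [d] contributes to the sum of the [x_i y_i]. *)
  rewrite (bigD1 (Ordinal (ltn_pmod n (ltn0Sn r)))) //= big1 => [|j jn].
    by rewrite addr0 XP YP /lact /= eqxx -divn_eq.
  by rewrite XP YP /lact /=; case: eqP => // e0; case/eqP: jn; apply: val_inj.
move=> M [sep card iso1 isoH]; exists M; split=> // m n /isoH.
exact: (hspan_iso_mod v_inj vP).
Qed.
End Leavitt.

(** * Powers *)

Lemma coprime_family_exists (T : finType) (r : nat) : (0 < r)%N ->
  exists P : T -> nat, [/\ forall t, (1 < P t)%N,
    forall t t', t != t' -> coprime (P t) (P t') & forall t, coprime (P t) r].
Proof.
move=> r0; pose q := fix q n := if n is k.+1 then sval (prime_above (q k)) else sval (prime_above r).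
have qpr n : prime (q n) by case: n => [|n] /=; case: prime_above.
have qS n : (q n < q n.+1)%N by rewrite /=; case: prime_above.
have qlt m n : (m < n)%N -> (q m < q n)%N.
  elim: n => // n IH; rewrite ltnS leq_eqVlt => /predU1P[->|/IH h]; first exact: qS.
  exact: ltn_trans h (qS n).
have rq n : (r < q n)%N.
  have h0 : (r < q 0%N)%N by rewrite /=; case: prime_above.
  by case: n => // n; apply: ltn_trans h0 (qlt _ _ _).
exists (fun t => q (enum_rank t)); split=> [t|t t' tt'|t].
- exact: prime_gt1.
- rewrite prime_coprime // dvdn_prime2 //.
  have : (enum_rank t : nat) != enum_rank t' by rewrite (inj_eq val_inj) (inj_eq enum_rank_inj).
  by rewrite neq_ltn => /orP[/qlt|/qlt]; case: ltngtP.
by rewrite prime_coprime // gtnNdvd.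
Qed.

Lemma group_iso_refl (A : zmodType) : group_iso A A.
Proof. by exists id; split=> //; exists id. Qed.

Lemma group_iso_sym (A B : zmodType) : group_iso A B -> group_iso B A.
Proof.
move=> /group_iso_additive[f [g [fK gK]]]; exists g; split; last by exists f.
exact: raddfD.
Qed.

Lemma group_iso_trans (A B C : zmodType) : group_iso A B -> group_iso B C -> group_iso A C.
Proof.
move=> [f [fD fbij]] [g [gD gbij]]; exists (g \o f); split; last exact: bij_comp.
by move=> x y; rewrite /= fD gD.
Qed.

Lemma group_iso_rV_add (M : zmodType) a b c :
  group_iso ('rV[M]_a) ('rV[M]_b) -> group_iso ('rV[M]_(a + c)) ('rV[M]_(b + c)).
Proof.
move=> [f [fD [g fK gK]]].
exists (fun x => row_mx (f (lsubmx x)) (rsubmx x)); split.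
  move=> x y; rewrite add_row_mx -fD; congr (row_mx (f _) _); apply/rowP => i; by rewrite !mxE.
exists (fun x => row_mx (g (lsubmx x)) (rsubmx x)) => x.
  by rewrite row_mxKl row_mxKr fK hsubmxK.
by rewrite row_mxKl row_mxKr gK hsubmxK.
Qed.

(** Replacing one copy of [M] by [r.+1] copies adds [r] to the exponent; this is repeated from the
    smaller exponent, which is positive. *)
Lemma group_iso_rV_mod (M : zmodType) r : group_iso ('rV[M]_1) ('rV[M]_r.+1) ->
  forall m k, (0 < m)%N -> (0 < k)%N -> m = k %[mod r] -> group_iso ('rV[M]_m) ('rV[M]_k).
Proof.
move=> iso1.
have isoS m : (0 < m)%N -> group_iso ('rV[M]_m) ('rV[M]_(m + r)).
  case: m => // m _; have := group_iso_rV_add m iso1.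
  by rewrite add1n addSn addnC -addSn.
have isoM m q : (0 < m)%N -> group_iso ('rV[M]_m) ('rV[M]_(m + q * r)).
  move=> m0; elim: q => [|q IH]; first by rewrite mul0n addn0; apply: group_iso_refl.
  apply: group_iso_trans IH _; rewrite mulSnr addnA; apply: isoS.
  by rewrite addn_gt0 m0.
have wl m k : (0 < m)%N -> (m <= k)%N -> m = k %[mod r] -> group_iso ('rV[M]_m) ('rV[M]_k).
  move=> m0 mk /eqP; rewrite eq_sym eqn_mod_dvd // => /dvdnP[q qE].
  by have := isoM m q m0; rewrite -qE subnKC.
move=> m k m0 k0 mk; have [h|/ltnW h] := leqP m k; first exact: wl.
by apply/group_iso_sym/wl.
Qed.

Theorem theorem0p1 :
  forall r : nat, (0 < r)%N ->
  exists M : zmodType,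
    aleph1_separable M /\ card_aleph1 M /\
    forall m k : nat, (0 < m)%N -> (0 < k)%N ->
      (group_iso ('rV[M]_m) ('rV[M]_k) <-> m = k %[mod r]).
Proof.
move=> r r0.
have [P [P1 P2 P3]] := coprime_family_exists (option (option (option ('I_r.+1 * bool)))) r0.
have [M [sep card iso1 isoM]] := leavitt_module_exists r0 P1 P2 P3.
exists M; split=> //; split=> // m k m0 k0; split; first exact: isoM.
exact: group_iso_rV_mod.
Qed.
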